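(* Let $f(\xi)=\sum_{i,j,k,\ell=1}^3 C_{ijk\ell}\,\xi_{ij}\xi_{k\ell}$, $\xi\in\mathbb R^{3\times 3}$, be a real quadratic form (with $C$ a real fourth-order tensor) that is quasiconvex. Let $T(y)$ be the $y$-matrix (acoustic tensor) of $f$. Assume that the polynomial $\det T(y)$ in $y\in\mathbb R^3$ is a perfect square (i.e. the square of a polynomial with real coefficients). Then $f$ is either extremal, or polyconvex, or a sum of a rank-one form and an extremal form, where the extremal form has a $y$-matrix with identically zero determinant.
   Context: All polynomials and forms have real coefficients. Quasiconvexity: a quadratic form $f$ on $\mathbb R^{3\times 3}$ is quasiconvex (for quadratic forms this is equivalent to rank-one convexity) if and only if $f(x\otimes y)\ge 0$ for all $x,y\in\mathbb R^3$, where $x\otimes y=(x_iy_j)_{i,j}$. This may be taken as the definition. One writes $f(x,y)$ for $f(x\otimes y)$. $y$-matrix (acoustic tensor): the unique symmetric $3\times 3$ matrix $T(y)$, whose entries are quadratic forms in $y$, such that $f(x\otimes y)=x\,T(y)\,x^T$ for all $x,y\in\mathbb R^3$ ($x$ a row vector). Rank-one form: the square $\big(\sum_{i,j}b_{ij}\xi_{ij}\big)^2$ of a (nonzero) linear form on $\mathbb R^{3\times 3}$. Extremal form: a quasiconvex quadratic form $f$ is extremal if one cannot subtract a rank-one form from it while preserving quasiconvexity, i.e. there is no nonzero matrix $B\in\mathbb R^{3\times 3}$ with $f(x\otimes y)-(xBy^T)^2\ge 0$ for all $x,y\in\mathbb R^3$. Polyconvexity: a quadratic form $f$ on $\mathbb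 R^{3\times 3}$ is polyconvex if and only if it is the sum of a convex (i.e. positive semidefinite) quadratic form and a linear combination of the $2\times 2$ minors of $\xi$ (a quadratic Null-Lagrangian); equivalently, $f(x\otimes y)$ is a sum of squares of real linear combinations of the products $x_iy_j$. This may be taken as the definition. Quadratic forms that differ by a Null-Lagrangian (a linear combination of $2\times 2$ minors of $\xi$) are identified; such forms agree on all $x\otimes y$. *)

(* Defs.v *)
From mathcomp Require Import all_boot all_order all_algebra.
From mathcomp Require Import reals mpoly zify ring.

Set Implicit Arguments.
Unset Strict Implicit.
Unset Printing Implicit Defensive.

Import Order.TTheory GRing.Theory Num.Theory.
Local Open Scope ring_scope.

Definition tensor4 (R : Type) := 'I_3 -> 'I_3 -> 'I_3 -> 'I_3 -> R.

Definition quad_form (R : realType) (C : tensor4 R) (xi : 'M[R]_3) : R :=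
  \sum_i \sum_j \sum_k \sum_l C i j k l * xi i j * xi k l.

(* Vectors are row vectors, so x^T *m y is the tensor product of x and y.
   The predicates below are only meant for quadratic forms f; for those,
   nonnegativity on rank-one matrices is quasiconvexity. *)
Definition quasiconvex (R : realType) (f : 'M[R]_3 -> R) : Prop :=
  forall x y : 'rV[R]_3, 0 <= f (x^T *m y).

Definition rank_one_form (R : realType) (B xi : 'M[R]_3) : R :=
  (\sum_i \sum_j B i j * xi i j) ^+ 2.

Definition extremal (R : realType) (f : 'M[R]_3 -> R) : Prop :=
  quasiconvex f /\
  ~ exists2 B : 'M[R]_3, B != 0 &
      quasiconvex (fun xi => f xi - rank_one_form B xi).

(* \det (row' i (col' j xi)) is the 2 x 2 minor of xi omitting row i and
   column j. *)
Definition null_lagrangian (R : realType) (N xi : 'M[R]_3) : R :=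
  \sum_i \sum_j N i j * \det (row' i (col' j xi)).

Definition polyconvex (R : realType) (f : 'M[R]_3 -> R) : Prop :=
  exists (Q : tensor4 R) (N : 'M[R]_3),
    (forall xi, 0 <= quad_form Q xi) /\
    (forall xi, f xi = quad_form Q xi + null_lagrangian N xi).

(* The y-matrix. C need not have any symmetry, hence the symmetrization in
   (i, k); ymatrix_spec and ymatrix_uniq show that this is the only symmetric
   matrix T of quadratic forms in y with f (x^T *m y) = x T(y) x^T. *)
Definition ymatrix (R : realType) (C : tensor4 R) : 'M[{mpoly R[3]}]_3 :=
  \matrix_(i, k) \sum_j \sum_l
    ((C i j k l + C k j i l) / 2) *: ('X_j * 'X_l).

Definition eval_ymatrix (R : realType) (T : 'M[{mpoly R[3]}]_3)
    (y : 'rV[R]_3) : 'M[R]_3 :=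
  map_mx (meval (fun j => y 0 j)) T.

Definition is_ymatrix (R : realType) (f : 'M[R]_3 -> R)
    (T : 'M[{mpoly R[3]}]_3) : Prop :=
  [/\ T^T = T,
      forall i k, T i k \is 2.-homog &
      forall x y : 'rV[R]_3,
        f (x^T *m y) = (x *m eval_ymatrix T y *m x^T) 0 0].

Lemma ymatrix_spec (R : realType) (C : tensor4 R) :
  is_ymatrix (quad_form C) (ymatrix C).
Proof.
split.
- apply/matrixP => i k; rewrite !mxE.
  by apply: eq_bigr => j _; apply: eq_bigr => l _; rewrite addrC.
- move=> i k; rewrite mxE.
  apply: rpred_sum => j _; apply: rpred_sum => l _; apply: dhomogZ.
  by rewrite -mpolyXD dhomogX /= mdegD !mdeg1.
- move=> x y; rewrite /quad_form.
  pose F i k := \sum_j \sum_l C i j k l * (x 0 i * y 0 j) * (x 0 k * y 0 l).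
  have -> : \sum_i \sum_j \sum_k \sum_l
      C i j k l * (x^T *m y) i j * (x^T *m y) k l = \sum_i \sum_k F i k.
    apply: eq_bigr => i _; rewrite exchange_big; apply: eq_bigr => k _.
    apply: eq_bigr => j _; apply: eq_bigr => l _.
    by rewrite !mxE !big_ord1 !mxE.
  have -> : (x *m eval_ymatrix (ymatrix C) y *m x^T) 0 0
      = \sum_i \sum_k (F i k + F k i) / 2.
    rewrite mxE exchange_big /=.
    apply: eq_bigr => k _; rewrite mxE big_distrl /=.
    apply: eq_bigr => i _; rewrite !mxE.
    rewrite raddf_sum big_distrr big_distrl /=.
    rewrite /F -big_split big_distrl /=; apply: eq_bigr => j _.
    rewrite raddf_sum big_distrr big_distrl /= -big_split big_distrl /=.
    apply: eq_bigr => l _.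
    rewrite mevalZ mevalM !mevalXU.
    by field.
  pose S := \sum_i \sum_k F i k.
  have -> : \sum_i \sum_k (F i k + F k i) / 2 = (S + S) / 2.
    have {2}-> : S = \sum_i \sum_k F k i by rewrite /S exchange_big.
    rewrite /S -big_split big_distrl /=.
    by apply: eq_bigr => i _; rewrite -big_split big_distrl.
  by rewrite -/S; field.
Qed.

Lemma homog2_eq0 (R : realType) (p : {mpoly R[3]}) :
  p \is 2.-homog -> (forall y : 'rV[R]_3, p.@[fun j => y 0 j] = 0) -> p = 0.
Proof.
move=> hp p0.
pose w (m : 'X_{1..3}) : nat := (\sum_(i < 3) 3 ^ i * m i)%N.
pose q : {poly R} := \sum_(m <- msupp p) p@_m *: 'X^(w m).
have q0 : q = 0.
  apply/eqP; apply: contraT => nz_q.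
  pose rs := [seq i%:R : R | i <- iota 0 (size q)].
  have := @max_poly_roots _ q rs nz_q; rewrite size_map size_iota ltnn => -> //.
    apply/allP => _ /mapP[n _ ->]; apply/rootP.
    rewrite -[RHS](p0 (\row_j n%:R ^+ (3 ^ j))) mevalE horner_sum.
    apply: eq_bigr => m _; rewrite hornerZ hornerXn; congr (_ * _).
    rewrite /w expr_sum; apply: eq_bigr => i _; by rewrite mxE exprM.
  rewrite map_inj_uniq ?iota_uniq // => a b /eqP.
  by rewrite eqr_nat => /eqP.
have w_inj : {in msupp p &, injective w}.
  move=> m m' /(dhomog_mf hp) /= + /(dhomog_mf hp) /=.
  rewrite !mdegE /w !big_ord_recl !big_ord0 /=.
  rewrite (_ : 3 ^ 0 = 1)%N // (_ : 3 ^ bump 0 0 = 3)%N //.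
  rewrite (_ : 3 ^ bump 0 (bump 0 0) = 9)%N // => h1 h2 h3.
  apply/mnmP => -[[|[|[|//]]] lt_i].
  + rewrite (_ : Ordinal lt_i = ord0); [lia | exact: val_inj].
  + rewrite (_ : Ordinal lt_i = lift ord0 ord0); [lia | exact: val_inj].
  + rewrite (_ : Ordinal lt_i = lift ord0 (lift ord0 ord0)); [lia|].
    exact: val_inj.
apply/mpolyP => m; rewrite mcoeff0.
have [m_p|] := boolP (m \in msupp p); last by move/memN_msupp_eq0.
have := congr1 (fun r : {poly R} => r`_(w m)) q0.
rewrite coef0 /q coef_sum (bigD1_seq m) ?msupp_uniq //= coefZ coefXn eqxx mulr1.
rewrite big_seq_cond big1 ?addr0 // => m' /andP[m'_p ne].
rewrite coefZ coefXn; case: eqP => [/(w_inj _ _ m_p m'_p) e|]; last by rewrite mulr0.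
by rewrite e eqxx in ne.
Qed.

Lemma ymatrix_uniq (R : realType) (C : tensor4 R) (T : 'M[{mpoly R[3]}]_3) :
  is_ymatrix (quad_form C) T -> T = ymatrix C.
Proof.
have := ymatrix_spec C; move: (ymatrix C) => Y [sY hY eY] [sT hT eT].
have sTE a b : T b a = T a b by rewrite -{2}sT mxE.
have sYE a b : Y b a = Y a b by rewrite -{2}sY mxE.
apply/matrixP => i k; apply/eqP; rewrite -subr_eq0; apply/eqP/homog2_eq0.
  by apply: rpredB; [apply: hT | apply: hY].
move=> y; pose D := eval_ymatrix T y - eval_ymatrix Y y.
have sD a b : D a b = D b a by rewrite !mxE sTE sYE.
have D0 (x : 'rV[R]_3) : (x *m D *m x^T) 0 0 = 0.
  rewrite mulmxBr mulmxBl [LHS]mxE.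
  by rewrite [X in _ + X]mxE -eT -eY subrr.
have DE : D i k = (T i k - Y i k).@[fun j => y 0 j] by rewrite !mxE raddfB.
rewrite -DE; move: D sD D0 {DE} => D sD D0.
have De a b : ((delta_mx 0 a : 'rV[R]_3) *m D *m (delta_mx 0 b : 'rV[R]_3)^T) 0 0
    = D a b.
  by rewrite -rowE trmx_delta -colE mxE mxE.
have E a b : D a b + D b a = 0.
  have := D0 (delta_mx 0 a + delta_mx 0 b).
  rewrite [(_ + _)^T]linearD !mulmxDl !mulmxDr /=.
  rewrite [LHS]mxE [X in X + _]mxE [X in _ + X]mxE !De.
  have := D0 (delta_mx 0 a); have := D0 (delta_mx 0 b).
  by rewrite !De => -> ->; rewrite add0r addr0 addrC.
by have := E i k; rewrite (sD k i) -mulr2n => /eqP; rewrite mulrn_eq0 => /eqP.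
Qed.

Definition perfect_square (S : pzRingType) (p : S) : Prop :=
  exists q : S, p = q ^+ 2.

(* Main.v *)
(** The two alternatives "extremal" or "polyconvex" already exhaust all cases.

    Write f(x, y) for f on rank-one matrices. The key fact is that f is a sum of
    squares of bilinear forms as soon as T(y) is singular for all y in a plane,
    say y3 = 0. The kernel of T(y) on that plane is spanned by a vector x(y)
    which can be brought to one of the forms e1, (y1, y2, 0), (y1^2, y2^2, y1y2).
    Since f is nonnegative and vanishes at (x(y), y), so does the part of f that
    is linear in y3, and f can be completed to squares: in the first case what
    remains is a nonnegative form in two x-variables and three y-variables, in
    the second one f is a quadratic form in six products that sweep out a
    quadric, so the S-lemma applies, in the third one what remains is y3^2 times
    a nonnegative quadratic form in x.

    Let now det T = q^2 and f - (x B y^T)^2 be nonnegative, B <> 0. Put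
    b = y B^T and p = b adj(T) b^T; then 0 <= p <= q^2. Either the cubic q has
    a real linear factor, so that T is singular on a plane, or q is irreducible,
    so that p, which vanishes on the real curve q = 0, is k q^2 with a constant
    k > 0. In that case f - k^-1 (x B y^T)^2 is still nonnegative and its
    y-matrix has determinant q^2 - k^-1 p = 0. *)
Require Import Defs.
From mathcomp Require Import all_boot all_order all_algebra.
From mathcomp Require Import boolp classical_sets reals topology normedtype derive.
From mathcomp Require Import zify ring lra.
From mathcomp Require Import -(notations) mpoly.

Set Implicit Arguments.
Unset Strict Implicit.
Unset Printing Implicit Defensive.

Import Order.TTheory GRing.Theory Num.Theory numFieldNormedType.Exports.
Local Open Scope ring_scope.

(** * Quadratic functions and the S-lemma *)

(** Encoded by a symmetric bilinear form rather than by coefficients, so that pullback along linear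
    maps and restriction to lines need no basis. *)
Definition quadratic (R : realType) (V : lmodType R) (q : V -> R) : Prop :=
  exists b : V -> V -> R,
    [/\ forall u v, b u v = b v u,
        forall a u v w, b (a *: u + v) w = a * b u w + b v w &
        forall v, q v = b v v].

Section Quadratic.
Variable R : realType.
Implicit Types V W : lmodType R.

(** Polarisation supplies the bilinear form. Both hypotheses are polynomial identities, which [ring]
    settles for an explicit form in matrix entries. *)
Lemma quadratic_polar V (q : V -> R) :
  (forall a u v w, q (a *: u + v + w) - q (a *: u + v) - q w =
     a * (q (u + w) - q u - q w) + (q (v + w) - q v - q w)) ->
  (forall v, q (v + v) = 4 * q v) -> quadratic q.
Proof.
move=> lin dbl; exists (fun u v => (q (u + v) - q u - q v) / 2); split.
- by move=> u v; rewrite [v + u]addrC; ring.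
- by move=> a u v w; rewrite lin; field.
- by move=> v; rewrite dbl; field.
Qed.

Lemma quadratic_ext V (p q : V -> R) : p =1 q -> quadratic p -> quadratic q.
Proof. by move=> e [b [h1 h2 h3]]; exists b; split=> // v; rewrite -e. Qed.

Lemma quadraticD V (p q : V -> R) :
  quadratic p -> quadratic q -> quadratic (fun v => p v + q v).
Proof.
move=> [b [h1 h2 h3]] [c [k1 k2 k3]]; exists (fun u v => b u v + c u v); split.
- by move=> u v; rewrite h1 k1.
- by move=> a u v w; rewrite h2 k2; ring.
- by move=> v; rewrite h3 k3.
Qed.

Lemma quadraticZ V k (q : V -> R) : quadratic q -> quadratic (fun v => k * q v).
Proof.
move=> [b [h1 h2 h3]]; exists (fun u v => k * b u v); split.
- by move=> u v; rewrite h1.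
- by move=> a u v w; rewrite h2; ring.
- by move=> v; rewrite h3.
Qed.

Lemma quadratic_comp V W (q : V -> R) (g : W -> V) :
  linear g -> quadratic q -> quadratic (fun v => q (g v)).
Proof.
move=> lg [b [h1 h2 h3]]; exists (fun u v => b (g u) (g v)); split => //.
by move=> a u v w; rewrite lg h2.
Qed.

Lemma quadratic_line V (q : V -> R) u v : quadratic q ->
  exists c, forall s t, q (s *: u + t *: v) = s ^+ 2 * q u + s * t * c + t ^+ 2 * q v.
Proof.
move=> [b [h1 h2 h3]]; exists (2 * b u v) => s t.
have b0 w : b 0 w = 0.
  by have := h2 1 0 0 w; rewrite scale1r addr0 mul1r; lra.
have bZ k w z : b (k *: w) z = k * b w z.
  by rewrite -[k *: w]addr0 h2 b0 addr0.
rewrite !h3 h2 bZ (h1 u) (h1 v) !h2 !bZ (h1 v u); ring.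
Qed.

(* A pair u, v with G u > 0 > G v spans two isotropic lines of G; a positive
   combination of the values of F on them has no cross term. *)
Lemma isotropic_comparison V (F G : V -> R) u v :
  quadratic F -> quadratic G -> (forall w, G w = 0 -> 0 <= F w) ->
  0 < G u -> G v < 0 -> G v * F u <= F v * G u.
Proof.
move=> qF qG FG Gu Gv.
have [f Ff] := quadratic_line u v qF; have [g' Gg] := quadratic_line u v qG.
pose g := g' / 2.
have {}Gg s t : G (s *: u + t *: v) = s ^+ 2 * G u + 2 * (s * t * g) + t ^+ 2 * G v.
  by rewrite Gg /g; field.
have D0 : 0 < g ^+ 2 - G u * G v by nra.
pose r := Num.sqrt (g ^+ 2 - G u * G v).
have r2 : r ^+ 2 = g ^+ 2 - G u * G v by rewrite sqr_sqrtr // ltW.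
have r0 : 0 < r by rewrite sqrtr_gt0.
have rg : `|g| < r.
  by rewrite -ltr_sqr ?nnegrE ?normr_ge0 ?(ltW r0) // r2 real_normK ?num_real //; nra.
move: rg; rewrite ltr_norml => /andP[rg1 rg2].
(* This vector is isotropic for s = r and for s = -r. The two values of F are then added with the
   positive weights r + g and r - g, which cancels f. *)
have iso s : s ^+ 2 = r ^+ 2 -> 0 <= F ((s - g) *: u + G u *: v).
  by move=> s2; apply: FG; rewrite Gg; ring: s2 r2.
have Fp := iso r erefl; have := iso (- r); rewrite sqrrN => /(_ erefl) Fm.
rewrite !Ff in Fp Fm.
have h : 0 <= (r + g) * ((r - g) ^+ 2 * F u + (r - g) * G u * f + G u ^+ 2 * F v)
          + (r - g) * ((- r - g) ^+ 2 * F u + (- r - g) * G u * f + G u ^+ 2 * F v).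
  by apply: addr_ge0; apply: mulr_ge0 => //; lra.
have e : (r + g) * ((r - g) ^+ 2 * F u + (r - g) * G u * f + G u ^+ 2 * F v)
          + (r - g) * ((- r - g) ^+ 2 * F u + (- r - g) * G u * f + G u ^+ 2 * F v)
   = 2 * r * G u * (F v * G u - G v * F u) by ring: r2.
move: h; rewrite e pmulr_rge0 ?subr_ge0 //.
by rewrite !mulr_gt0.
Qed.

(** The multiplier must be at least -F/G where G > 0 and at most F/(-G) where G < 0. By
    [isotropic_comparison] every such lower bound is below every such upper bound, so the supremum
    of the lower bounds works. *)
Lemma S_lemma V (F G : V -> R) :
  quadratic F -> quadratic G -> (exists u, 0 < G u) -> (exists v, G v < 0) ->
  (forall w, G w = 0 -> 0 <= F w) -> exists l, forall w, 0 <= F w + l * G w.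
Proof.
move=> qF qG [u0 Gu0] [v0 Gv0] FG.
pose A : set R := fun r => exists2 u, 0 < G u & r = - (F u / G u).
have ubA v : G v < 0 -> forall r, A r -> r <= F v / - G v.
  move=> Gv r [u Gu ->].
  have := isotropic_comparison qF qG FG Gu Gv.
  rewrite ler_pdivlMr ?oppr_gt0 // -mulNr mulrAC ler_pdivrMr //; lra.
have A0 : A (- (F u0 / G u0)) by exists u0.
have supA : has_sup A.
  by split; [exists (- (F u0 / G u0)) | exists (F v0 / - G v0) => r; apply: ubA].
exists (sup A) => w; case: (ltgtP (G w) 0) => Gw; last by rewrite Gw mulr0 addr0 FG.
- have : sup A <= F w / - G w.
    by apply: ge_sup => [|r]; [exists (- (F u0 / G u0)) | apply: ubA].
  by rewrite ler_pdivlMr ?oppr_gt0 //; lra.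
- have : - (F w / G w) <= sup A by apply: sup_upper_bound => //; exists w.
  by rewrite -mulNr ler_pdivrMr //; lra.
Qed.

End Quadratic.

(** * Quadratic forms on matrices and Null-Lagrangians *)

Section QuadraticSum.
Variable R : realType.
Implicit Types V W : lmodType R.

Lemma quadratic0 V : quadratic (fun _ : V => 0 : R).
Proof. by exists (fun _ _ => 0); split=> // *; rewrite mulr0 addr0. Qed.

Lemma quadraticM V (l m : V -> R) :
  scalar l -> scalar m -> quadratic (fun v => l v * m v).
Proof.
move=> ll lm; exists (fun u v => (l u * m v + l v * m u) / 2); split.
- by move=> u v; rewrite addrC.
- by move=> a u v w; rewrite ll lm; field.
- by move=> v; field.
Qed.

Lemma quadratic_sum V (I : Type) (r : seq I) (q : I -> V -> R) :
  (forall i, quadratic (q i)) -> quadratic (fun v => \sum_(i <- r) q i v).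
Proof.
move=> qq; elim: r => [|i r IH].
  by apply: quadratic_ext (quadratic0 V) => v; rewrite big_nil.
by apply: quadratic_ext (quadraticD (qq i) IH) => v; rewrite big_cons.
Qed.

Lemma quad_form_quadratic (C : tensor4 R) : quadratic (quad_form C).
Proof.
do 4!(apply: quadratic_sum => ?).
apply: (@quadratic_ext _ _ (fun xi : 'M[R]_3 => C _ _ _ _ * (xi _ _ * xi _ _))).
  by move=> xi; rewrite mulrA.
by apply/quadraticZ/quadraticM => a u v; rewrite !mxE.
Qed.

Lemma bilinear_quad_form (b : 'M[R]_3 -> 'M[R]_3 -> R) :
  (forall u v, b u v = b v u) ->
  (forall a u v w, b (a *: u + v) w = a * b u w + b v w) ->
  forall xi, b xi xi = quad_form (fun i j k l => b (delta_mx i j) (delta_mx k l)) xi.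
Proof.
move=> bC blin xi.
have b0 w : b 0 w = 0 by have := blin 1 0 0 w; rewrite scale1r addr0; lra.
have bsum I (r : seq I) (F : I -> 'M_3) w :
    b (\sum_(i <- r) F i) w = \sum_(i <- r) b (F i) w.
  elim: r => [|i r IH]; first by rewrite !big_nil b0.
  by rewrite !big_cons -[F i]scale1r blin IH scale1r mul1r.
have bZ k w z : b (k *: w) z = k * b w z.
  by rewrite -[k *: w]addr0 blin b0 addr0.
rewrite {1}[xi]matrix_sum_delta; apply: etrans (bsum _ _ _ _) _.
apply: eq_bigr => i _; apply: etrans (bsum _ _ _ _) _; apply: eq_bigr => j _.
rewrite bZ (bC _ xi) mulrC {1}[xi]matrix_sum_delta.
rewrite [X in X * _](bsum _ _ _ _) mulr_suml; apply: eq_bigr => k _.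
rewrite [X in X * _](bsum _ _ _ _) mulr_suml; apply: eq_bigr => l _.
by rewrite bZ bC; ring.
Qed.

Lemma quadratic_quad_form (q : 'M[R]_3 -> R) :
  quadratic q -> exists C : tensor4 R, q =1 quad_form C.
Proof.
move=> [b [bC blin qE]]; eexists => xi.
by rewrite qE; apply: bilinear_quad_form bC blin xi.
Qed.

Definition i0 : 'I_3 := @Ordinal 3 0 isT.
Definition i1 : 'I_3 := @Ordinal 3 1 isT.
Definition i2 : 'I_3 := @Ordinal 3 2 isT.

Lemma sum3E (S : nmodType) (F : 'I_3 -> S) : \sum_i F i = F i0 + F i1 + F i2.
Proof.
rewrite !big_ord_recr big_ord0 /= add0r.
by congr (F _ + F _ + F _); apply: val_inj.
Qed.

Lemma minorE (xi : 'M[R]_3) (a b : 'I_3) :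
  \det (row' a (col' b xi)) =
  xi (lift a ord0) (lift b ord0) * xi (lift a ord_max) (lift b ord_max) -
  xi (lift a ord0) (lift b ord_max) * xi (lift a ord_max) (lift b ord0).
Proof.
rewrite (expand_det_row _ ord0) !big_ord_recl big_ord0 /cofactor !det_mx11 !mxE /=.
have -> : lift ord0 (0 : 'I_1) = ord_max :> 'I_2 by exact: val_inj.
have -> : lift ord_max (0 : 'I_1) = ord0 :> 'I_2 by exact: val_inj.
by rewrite expr0 expr1 addr0 mul1r mulN1r mulrN.
Qed.

Lemma lift3E :
  (lift i0 (@ord0 1) = i1) * (lift i0 (@ord_max 1) = i2) *
  (lift i1 (@ord0 1) = i0) * (lift i1 (@ord_max 1) = i2) *
  (lift i2 (@ord0 1) = i0) * (lift i2 (@ord_max 1) = i1).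
Proof. by do !split; apply: val_inj. Qed.

(** Evaluation at products of sums of unit vectors kills the coefficient of any two entries in a
    common row or column, and makes the others change sign when the column indices are exchanged.
    What is left is a combination of minors. *)
Lemma rank_one_null (q : 'M[R]_3 -> R) :
  quadratic q -> (forall x y : 'rV_3, q (x^T *m y) = 0) ->
  exists N, q =1 null_lagrangian N.
Proof.
move=> [b [bC blin qE]] q0.
pose u (i : 'I_3) : 'rV[R]_3 := delta_mx 0 i.
have bD v w z : b (v + w) z = b v z + b w z by rewrite -[v]scale1r blin scale1r mul1r.
have bDr v w z : b z (v + w) = b z v + b z w by rewrite !(bC z) bD.
pose t i j k l := b ((u i)^T *m u j) ((u k)^T *m u l).
have tE i j k l : b ((u i)^T *m u j) ((u k)^T *m u l) = t i j k l by [].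
have tC i j k l : t k l i j = t i j k l by apply: bC.
have t1 i j : t i j i j = 0 by rewrite /t -qE q0.
have t2 i j l : t i j i l = 0.
  have := q0 (u i) (u j + u l).
  rewrite mulmxDr qE bD !bDr !tE !t1 (tC i l i j); lra.
have t3 i j k : t i j k j = 0.
  have := q0 (u i + u k) (u j).
  rewrite [(_ + _)^T]linearD mulmxDl qE bD !bDr !tE !t1 (tC i j k j); lra.
have t4 i j k l : t i l k j = - t i j k l.
  have := q0 (u i + u k) (u j + u l).
  rewrite [(_ + _)^T]linearD mulmxDl !mulmxDr qE !bD !bDr !tE !(t1, t2, t3).
  rewrite (tC i j k l) (tC i l k j); lra.
(* The diagonal product of the minor omitting row i and column j occurs in q in both orders of its
   factors, hence the 2. *)
exists (\matrix_(i < 3, j < 3) (2 * t (lift i ord0) (lift j ord0)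
                              (lift i ord_max) (lift j ord_max))) => xi.
rewrite /null_lagrangian !sum3E !mxE !minorE !lift3E.
have eE i j : delta_mx i j = (u i)^T *m u j.
  by rewrite /u trmx_delta mul_delta_mx.
have dE i j k l : b (delta_mx i j) (delta_mx k l) = t i j k l by rewrite !eE.
rewrite qE (bilinear_quad_form bC blin) /quad_form !sum3E !dE.
rewrite !(t1, t2, t3) !(tC i0 _ i1 _) !(tC i0 _ i2 _) !(tC i1 _ i2 _).
rewrite !(t4 _ i0 _ i1) !(t4 _ i0 _ i2) !(t4 _ i1 _ i2); ring.
Qed.
End QuadraticSum.

(** * Biquadratic forms and sums of squares *)

Section Biforms.
Variable R : realType.
Local Notation vec := 'rV[R]_3.
Implicit Types (f g : vec -> vec -> R) (x y : vec).

Definition v3 (a b c : R) : vec := \row_j nth 0 [:: a; b; c] j.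

Lemma v3E a b c : (v3 a b c 0 i0 = a) * (v3 a b c 0 i1 = b) * (v3 a b c 0 i2 = c).
Proof. by rewrite !mxE. Qed.

Lemma v3_eta x : x = v3 (x 0 i0) (x 0 i1) (x 0 i2).
Proof.
by apply/rowP => -[[|[|[|//]]] lt_i]; rewrite mxE /=; congr (x 0 _); apply: val_inj.
Qed.

Lemma v3_neq0 a b c : (v3 a b c != 0) = ~~ [&& a == 0, b == 0 & c == 0].
Proof.
congr (~~ _); apply/eqP/and3P => [e|[/eqP-> /eqP-> /eqP->]].
  by have := v3E a b c; rewrite e !mxE => -[[<- <-] <-]; rewrite eqxx.
by apply/rowP => -[[|[|[|//]]] lt_i]; rewrite !mxE.
Qed.

Lemma rank1E x y i j : (x^T *m y) i j = x 0 i * y 0 j.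
Proof. by rewrite !mxE big_ord1 !mxE. Qed.

(** A function of x and y, so that forms differing by a Null-Lagrangian become equal. *)
Definition biform f : Prop :=
  exists2 q : 'M[R]_3 -> R, quadratic q & forall x y, f x y = q (x^T *m y).

Definition psd f : Prop := forall x y, 0 <= f x y.

(** A form that is nonnegative on all matrices is a sum of squares of linear forms, so this is
    polyconvexity read off on rank-one matrices. *)
Definition sos f : Prop :=
  exists q : 'M[R]_3 -> R,
    [/\ quadratic q, forall xi, 0 <= q xi & forall x y, f x y = q (x^T *m y)].

Lemma sos_ext f g : (forall x y, f x y = g x y) -> sos f -> sos g.
Proof. by move=> e [q [h1 h2 h3]]; exists q; split=> // x y; rewrite -e. Qed.

Lemma sosD f g : sos f -> sos g -> sos (fun x y => f x y + g x y).
Proof.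
move=> [p [p1 p2 p3]] [q [q1 q2 q3]]; exists (fun xi => p xi + q xi); split.
- exact: quadraticD.
- by move=> xi; apply: addr_ge0.
- by move=> x y; rewrite p3 q3.
Qed.

Lemma biformB f g : biform f -> biform g -> biform (fun x y => f x y - g x y).
Proof.
move=> [p qp pE] [q qq qE]; exists (fun xi => p xi + -1 * q xi).
  exact/quadraticD/quadraticZ.
by move=> x y; rewrite pE qE mulN1r.
Qed.

Lemma biform_coord f (P S : 'M[R]_3) :
  biform f -> biform (fun x y => f (x *m P) (y *m S)).
Proof.
move=> [q qq qE]; exists (fun xi => q (P^T *m xi *m S)).
  apply: quadratic_comp qq => a u v.
  by rewrite mulmxDr mulmxDl -scalemxAr -scalemxAl.
by move=> x y; rewrite qE trmx_mul !mulmxA.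
Qed.

Lemma sos_coord f (P S : 'M[R]_3) : P \in unitmx -> S \in unitmx ->
  sos (fun x y => f (x *m P) (y *m S)) -> sos f.
Proof.
move=> uP uS [q [qq q0 qE]]; exists (fun xi => q ((invmx P)^T *m xi *m invmx S)).
split=> //.
  apply: quadratic_comp qq => a u v.
  by rewrite mulmxDr mulmxDl -scalemxAr -scalemxAl.
move=> x y; rewrite -{1}(mulmxKV uP x) -{1}(mulmxKV uS y) qE.
by rewrite trmx_mul !mulmxA.
Qed.

Lemma sos_polyconvex (C : tensor4 R) :
  sos (fun x y => quad_form C (x^T *m y)) -> polyconvex (quad_form C).
Proof.
move=> [q [qq q0 qE]]; have [Q QE] := quadratic_quad_form qq.
have [] := @rank_one_null R (fun xi => quad_form C xi + -1 * q xi).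
- exact/quadraticD/quadraticZ/qq/quad_form_quadratic.
- by move=> x y; rewrite qE; ring.
move=> N NE; exists Q, N; split=> xi; first by rewrite -QE.
by rewrite -NE -QE; ring.
Qed.

(* The coefficients of biq are indexed by the monomials
   x1^2, x2^2, x3^2, x2x3, x1x3, x1x2, in this order, and likewise in y. *)
Definition q3 (a : nat -> R) (x1 x2 x3 : R) : R :=
  a 0%N * x1 ^+ 2 + a 1%N * x2 ^+ 2 + a 2%N * x3 ^+ 2 +
  a 3%N * (x2 * x3) + a 4%N * (x1 * x3) + a 5%N * (x1 * x2).

Definition biq (c : nat -> nat -> R) (x1 x2 x3 y1 y2 y3 : R) : R :=
  q3 (fun m => q3 (c m) y1 y2 y3) x1 x2 x3.

Lemma biform_biq f : biform f ->
  exists c, forall x1 x2 x3 y1 y2 y3 : R,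
    f (v3 x1 x2 x3) (v3 y1 y2 y3) = biq c x1 x2 x3 y1 y2 y3.
Proof.
move=> [q /quadratic_quad_form[C qC] fq].
pose s (n : nat) (A : 'I_3 -> 'I_3 -> R) :=
  match n with
  | 0 => A i0 i0 | 1 => A i1 i1 | 2 => A i2 i2
  | 3 => A i1 i2 + A i2 i1 | 4 => A i0 i2 + A i2 i0 | _ => A i0 i1 + A i1 i0
  end.
exists (fun m n => s m (fun i k => s n (fun j l => C i j k l))) => *.
rewrite fq qC /quad_form !sum3E !rank1E !v3E /biq /q3 /s; ring.
Qed.

End Biforms.

(** * Two by three forms *)

Ltac quadr := apply: quadratic_polar => [? ? ? ?|?]; rewrite !mxE; ring.

Section TwoByThree.
Variable R : realType.
Local Notation vec := 'rV[R]_3.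
Implicit Types (f g : vec -> vec -> R).

Lemma eq_ge0 (a b : R) : a = b -> 0 <= a -> 0 <= b.
Proof. by move->. Qed.

Lemma affine_ge0 (a b : R) : (forall t, 0 <= a + t * b) -> b = 0.
Proof.
move=> h; apply/eqP; apply: contraT => b0.
(* At this t the affine function equals -1. *)
have := h (- (a + 1) / b).
by rewrite mulfVK // opprD addNKr oppr_ge0 ler10.
Qed.

(** The limit as t decreases to 0. It serves below to pass from generic to exceptional points. *)
Lemma quad_near0 (a b c : R) :
  (forall t, 0 < t -> 0 <= a + t * b + t ^+ 2 * c) -> 0 <= a.
Proof.
move=> h; rewrite leNgt; apply/negP => a0.
(* With t M = -a / 2 and t <= 1 the terms in b and c add up to less than -a / 2, so the whole would
   be negative. *)
pose M := 1 + `|a| + `|b| + `|c|.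
have [hb hc] : b <= `|b| /\ c <= `|c| by rewrite !ler_norm.
have [n1 n2] : 0 <= `|b| /\ 0 <= `|c| by rewrite !normr_ge0.
have aE : `|a| = - a by rewrite ltr0_norm.
have M0 : 0 < M by rewrite /M aE; lra.
have [t tM'] : exists t, t = - a / (2 * M) by exists (- a / (2 * M)).
have t0 : 0 < t by rewrite tM' divr_gt0 ?mulr_gt0 // oppr_gt0.
have tM : t * M = - a / 2 by rewrite tM'; field; rewrite gt_eqF.
have t1 : t <= 1 by rewrite tM' ler_pdivrMr ?mulr_gt0 // /M aE; lra.
have tc : t ^+ 2 * c <= t * `|c|.
  rewrite (le_trans (ler_wpM2l _ hc)) ?sqr_ge0 // ler_wpM2r // expr2.
  by rewrite -[leRHS]mulr1 ler_wpM2l // ltW.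
have tb : t * b <= t * `|b| by rewrite ler_wpM2l // ltW.
have t1a : 0 < t * (1 - a) by rewrite mulr_gt0 // subr_gt0 (lt_trans a0).
have := h t t0; move: tM; rewrite /M aE; lra.
Qed.

(** Division by t on either side of 0 and a limit give both signs of b. Applied at a zero of a
    nonnegative form, this kills the first-order terms there. *)
Lemma quad_nolin (b c : R) : (forall t, 0 <= t * b + t ^+ 2 * c) -> b = 0.
Proof.
move=> h; apply/eqP; rewrite eq_le; apply/andP; split.
  rewrite -oppr_ge0; apply: (@quad_near0 _ c 0) => t t0.
  rewrite mulr0 addr0 -(pmulr_rge0 _ t0).
  by have -> : t * (- b + t * c) = - t * b + (- t) ^+ 2 * c by ring.
apply: (@quad_near0 _ c 0) => t t0.
rewrite mulr0 addr0 -(pmulr_rge0 _ t0).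
by have -> : t * (b + t * c) = t * b + t ^+ 2 * c by ring.
Qed.

(** The 2 by 2 matrices of rank at most one are the zeros of the determinant G, so the S-lemma turns
    nonnegativity on them into a semidefinite F + l G. *)
Lemma sos_2x2 f : biform f ->
  (forall x2 x3 y2 y3 : R, 0 <= f (v3 0 x2 x3) (v3 0 y2 y3)) ->
  sos (fun x y : vec => f (v3 0 (x 0 i1) (x 0 i2)) (v3 0 (y 0 i1) (y 0 i2))).
Proof.
move=> /biform_biq[c cE] f0.
pose F (xi : 'M[R]_3) := c 1%N 1%N * xi i1 i1 ^+ 2 + c 1%N 2%N * xi i1 i2 ^+ 2 +
  c 1%N 3%N * (xi i1 i1 * xi i1 i2) + c 2%N 1%N * xi i2 i1 ^+ 2 +
  c 2%N 2%N * xi i2 i2 ^+ 2 + c 2%N 3%N * (xi i2 i1 * xi i2 i2) +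
  c 3%N 1%N * (xi i1 i1 * xi i2 i1) + c 3%N 2%N * (xi i1 i2 * xi i2 i2) +
  c 3%N 3%N * (xi i1 i1 * xi i2 i2).
pose G (xi : 'M[R]_3) := xi i1 i1 * xi i2 i2 - xi i1 i2 * xi i2 i1.
have qF : quadratic F by rewrite /F; quadr.
have qG : quadratic G by rewrite /G; quadr.
have FE (xi : 'M[R]_3) x2 x3 y2 y3 : xi i1 i1 = x2 * y2 -> xi i1 i2 = x2 * y3 ->
    xi i2 i1 = x3 * y2 -> xi i2 i2 = x3 * y3 ->
    F xi = f (v3 0 x2 x3) (v3 0 y2 y3).
  by rewrite cE /F /biq /q3 => -> -> -> ->; ring.
have [||xi Gxi|l Fl] := S_lemma qF qG.
- by exists 1%:M; rewrite /G !mxE /=; lra.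
- by exists (\matrix_(i, j) (i != j)%:R); rewrite /G !mxE /=; lra.
- have {Gxi} Gxi : xi i1 i1 * xi i2 i2 = xi i1 i2 * xi i2 i1.
    by move/eqP: Gxi; rewrite subr_eq0 => /eqP.
  (* Factor the singular block as a product of two vectors, with the first nonzero entry of its
     first row as pivot, or with x = (0, 1) if that row vanishes. *)
  have [a0|a0] := eqVneq (xi i1 i1) 0; last first.
    rewrite (FE xi 1 (xi i2 i1 / xi i1 i1) (xi i1 i1) (xi i1 i2)) ?mul1r ?mulfVK //.
    by apply: (mulfI a0); rewrite Gxi; field.
  move: Gxi; rewrite a0 mul0r => /esym/eqP; rewrite mulf_eq0.
  have [b0 _|b0 /= /eqP c0] := eqVneq (xi i1 i2) 0.
    by rewrite (FE xi 0 1 (xi i2 i1) (xi i2 i2)) ?mul1r ?mul0r.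
  rewrite (FE xi 1 (xi i2 i2 / xi i1 i2) 0 (xi i1 i2)) ?mul1r ?mulr0 //.
  by rewrite mulfVK.
- exists (fun xi => F xi + l * G xi); split=> //.
    exact/quadraticD/quadraticZ.
  by move=> x y; rewrite (FE _ (x 0 i1) (x 0 i2) (y 0 i1) (y 0 i2)) ?rank1E // /G !rank1E; ring.
Qed.

Lemma biform_sqr (l : 'M[R]_3 -> R) (k : R) :
  scalar l -> biform (fun x y : vec => k * l (x^T *m y) ^+ 2).
Proof.
by move=> ll; exists (fun xi => k * l xi ^+ 2) => //; apply/quadraticZ/quadraticM.
Qed.

Lemma sos_sqr (l : 'M[R]_3 -> R) (k : R) :
  scalar l -> 0 <= k -> sos (fun x y : vec => k * l (x^T *m y) ^+ 2).
Proof.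
move=> ll k0; exists (fun xi => k * l xi ^+ 2); split => //.
  exact/quadraticZ/quadraticM.
by move=> xi; rewrite mulr_ge0 ?sqr_ge0.
Qed.

(* Completing the square in y1: a zero at x = e2, y = e1 leaves x3^2 as the only
   coefficient of y1^2, and makes that of y1 divisible by x3. *)
Lemma sos_2x3_zero f : biform f ->
  (forall (x2 x3 : R) y, 0 <= f (v3 0 x2 x3) y) -> f (v3 0 1 0) (v3 1 0 0) = 0 ->
  sos (fun x y : vec => f (v3 0 (x 0 i1) (x 0 i2)) y).
Proof.
move=> bf f0 fz; have [c cE] := biform_biq bf.
have c10 : c 1%N 0%N = 0 by rewrite -fz cE /biq /q3; ring.
have c30 : c 3%N 0%N = 0.
  apply: (@quad_nolin _ (c 2%N 0%N)) => t.
  by apply: (eq_ge0 _ (f0 1 t (v3 1 0 0))); rewrite cE /biq /q3 c10; ring.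
have c15 : c 1%N 5%N = 0.
  apply: (@quad_nolin _ (c 1%N 1%N)) => t.
  by apply: (eq_ge0 _ (f0 1 0 (v3 1 t 0))); rewrite cE /biq /q3 c10; ring.
have c14 : c 1%N 4%N = 0.
  apply: (@quad_nolin _ (c 1%N 2%N)) => t.
  by apply: (eq_ge0 _ (f0 1 0 (v3 1 0 t))); rewrite cE /biq /q3 c10; ring.
pose k := c 2%N 0%N.
have k0 : 0 <= k.
  by apply: (eq_ge0 _ (f0 0 1 (v3 1 0 0))); rewrite cE /biq /q3 /k; ring.
(* Completing the square divides by k; if k = 0 the coefficients to be divided vanish as well,
   because f is then affine in y1. *)
have kh d : (k = 0 -> d = 0) -> exists e, d = 2 * k * e.
  have [-> dk|kn0 _] := eqVneq k 0; first by exists 0; rewrite dk // mulr0.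
  by exists (d / (2 * k)); field.
have klin (x2 x3 y2 y3 : R) : k = 0 ->
    y2 * (c 3%N 5%N * (x2 * x3) + c 2%N 5%N * x3 ^+ 2) +
    y3 * (c 3%N 4%N * (x2 * x3) + c 2%N 4%N * x3 ^+ 2) = 0.
  move=> kz; apply: (@affine_ge0 (biq c 0 x2 x3 0 y2 y3)) => t.
  apply: (eq_ge0 _ (f0 x2 x3 (v3 t y2 y3))); rewrite cE /biq /q3 c10 c30 c15 c14 -/k kz; ring.
have [e25 c25] : exists e, c 2%N 5%N = 2 * k * e.
  by apply: kh => kz; rewrite -(klin 0 1 1 0 kz); ring.
have [e24 c24] : exists e, c 2%N 4%N = 2 * k * e.
  by apply: kh => kz; rewrite -(klin 0 1 0 1 kz); ring.
have [e35 c35] : exists e, c 3%N 5%N = 2 * k * e.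
  apply: kh => kz; have := klin 1 1 1 0 kz; have := klin 0 1 1 0 kz; lra.
have [e34 c34] : exists e, c 3%N 4%N = 2 * k * e.
  apply: kh => kz; have := klin 1 1 0 1 kz; have := klin 0 1 0 1 kz; lra.
pose l (xi : 'M[R]_3) := xi i2 i0 +
   (e35 * xi i1 i1 + e34 * xi i1 i2 +
    e25 * xi i2 i1 + e24 * xi i2 i2).
have sl : scalar l by move=> a u v; rewrite /l !mxE; ring.
pose g (x y : vec) := f x y - k * l (x^T *m y) ^+ 2.
have bg : biform g by apply/biformB/biform_sqr.
have gE (x2 x3 y1 y2 y3 : R) :
    g (v3 0 x2 x3) (v3 y1 y2 y3) = g (v3 0 x2 x3) (v3 0 y2 y3).
  rewrite /g !cE /l !rank1E !v3E /biq /q3 c10 c30 c15 c14 -/k.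
  rewrite c25 c24 c35 c34; ring.
have g0 (x2 x3 y2 y3 : R) : 0 <= g (v3 0 x2 x3) (v3 0 y2 y3).
  have [d dE] := biform_biq bg.
  (* As g does not depend on y1, that variable can be chosen to make l vanish, and there g = f. The
     case x3 = 0 is a limit. *)
  have pos (z2 z3 : R) : z3 != 0 -> 0 <= g (v3 0 z2 z3) (v3 0 y2 y3).
    move=> z3n0; rewrite -(gE _ _ (- (e35 * (z2 * y2) + e34 * (z2 * y3) +
      e25 * (z3 * y2) + e24 * (z3 * y3)) / z3)).
    rewrite /g [X in _ - k * X](_ : _ = 0) ?mulr0 ?subr0 ?f0 //.
    by rewrite /l !rank1E !v3E; field.
  have [->|] := eqVneq x3 0; last exact: pos.
  apply: (@quad_near0 _ (x2 * q3 (d 3%N) 0 y2 y3) (q3 (d 2%N) 0 y2 y3)) => t t0.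
  by apply: (eq_ge0 _ (pos x2 t (lt0r_neq0 t0))); rewrite !dE /biq /q3; ring.
apply: sos_ext (sosD (sos_sqr sl k0) (sos_2x2 bg g0)) => x y.
rewrite -/(g _ _) -(gE _ _ (y 0 i0)) -v3_eta /g /l !rank1E !v3E; ring.
Qed.

Lemma complete_row (y : vec) : y != 0 ->
  exists2 S : 'M[R]_3, S \in unitmx & v3 1 0 0 *m S = y.
Proof.
move=> y0; have ry : \rank y = 1%N by rewrite rank_rV y0.
have re : \rank (v3 1 0 0 : vec) = 1%N by rewrite (rank_rV (v3 1 0 0 : vec)) v3_neq0 oner_eq0.
pose g : 'M[R]_3 := (v3 1 0 0)^T *m y.
have ge : v3 1 0 0 *m g = y.
  rewrite mulmxA [X in X *m _](_ : _ = 1%:M) ?mul1mx //.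
  by apply/rowP => i; rewrite !ord1 !mxE sum3E !mxE /=; ring.
have [|S uS SE] := @complete_unitmx R 1 3 (v3 1 0 0) g; first by rewrite ge ry re.
by exists S; rewrite // -SE.
Qed.

Lemma q3_continuous n (a : nat -> 'rV[R]_n -> R) (x1 x2 x3 : 'rV[R]_n -> R) :
  (forall m, continuous (a m)) -> continuous x1 -> continuous x2 -> continuous x3 ->
  continuous (fun z => q3 (fun m => a m z) (x1 z) (x2 z) (x3 z)).
Proof.
move=> ca c1 c2 c3 z.
have cM (g h : 'rV[R]_n -> R) m : continuous g -> continuous h ->
    {for z, continuous (fun z => a m z * (g z * h z))}.
  by move=> cg ch; exact: (cvgM (ca m z) (cvgM (cg z) (ch z))).
exact: (cvgD (cvgD (cvgD (cvgD (cvgD (cM _ _ 0%N c1 c1) (cM _ _ 1%N c2 c2))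
  (cM _ _ 2%N c3 c3)) (cM _ _ 3%N c2 c3)) (cM _ _ 4%N c1 c3)) (cM _ _ 5%N c1 c2)).
Qed.

(* t is the minimum of f over unit x in the (x2, x3)-plane and unit y. *)
Lemma biform_min f : biform f -> exists t (a b : R) y,
  [/\ a ^+ 2 + b ^+ 2 = 1, y != 0,
      f (v3 0 a b) y = t * (y 0 i0 ^+ 2 + y 0 i1 ^+ 2 + y 0 i2 ^+ 2) &
      forall x2 x3 y1 y2 y3 : R,
       t * (x2 ^+ 2 + x3 ^+ 2) * (y1 ^+ 2 + y2 ^+ 2 + y3 ^+ 2)
         <= f (v3 0 x2 x3) (v3 y1 y2 y3)].
Proof.
move=> /biform_biq[c cE].
(* The point (x2, x3, y1, y2, y3) is packed into one vector z; K is the product of the unit circle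
   and the unit sphere, closed inside the cube of side [-1, 1]. *)
pose j (n : nat) : 'I_5 := inord n.
pose F (z : 'rV[R]_5) := biq c 0 (z 0 (j 0%N)) (z 0 (j 1%N))
   (z 0 (j 2%N)) (z 0 (j 3%N)) (z 0 (j 4%N)).
pose nx (z : 'rV[R]_5) := z 0 (j 0%N) ^+ 2 + z 0 (j 1%N) ^+ 2.
pose ny (z : 'rV[R]_5) := z 0 (j 2%N) ^+ 2 + z 0 (j 3%N) ^+ 2 + z 0 (j 4%N) ^+ 2.
pose K : set 'rV[R]_5 := [set z | nx z = 1 /\ ny z = 1]%classic.
have cX (g : 'rV[R]_5 -> R) : continuous g -> continuous (fun z => g z ^+ 2).
  by move=> h z; apply: (cvgM (h z) (h z)).
have cz n : continuous (fun z : 'rV[R]_5 => z 0 (j n)) by exact: coord_continuous.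
have cXz n : continuous (fun z : 'rV[R]_5 => z 0 (j n) ^+ 2) by apply/cX/cz.
have cnx : continuous nx by move=> z; exact: (cvgD (cXz 0%N z) (cXz 1%N z)).
have cny : continuous ny by move=> z; exact: (cvgD (cvgD (cXz 2%N z) (cXz 3%N z)) (cXz 4%N z)).
have jE n : (n < 5)%N -> (j n == n :> nat) by move=> n5; rewrite inordK.
have bnd (z : 'rV[R]_5) : K z -> forall i, z 0 i \in `[-1, 1].
  have u1 (s r : R) : 0 <= r -> s ^+ 2 + r = 1 -> s \in `[-1, 1].
    by rewrite in_itv /= => r0 e; apply/andP; split; nra.
  rewrite /K /nx /ny /= => -[z1 z2] i.
  have -> : i = j i by apply: val_inj; rewrite /= inordK.
  case: i => -[|[|[|[|[|//]]]]] /= _.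
  - by apply: u1 z1; rewrite sqr_ge0.
  - by apply: (u1 _ (z 0 (j 0%N) ^+ 2)); rewrite ?sqr_ge0 // -z1; ring.
  - by apply: (u1 _ (z 0 (j 3%N) ^+ 2 + z 0 (j 4%N) ^+ 2)); rewrite ?addr_ge0 ?sqr_ge0 // -z2; ring.
  - by apply: (u1 _ (z 0 (j 2%N) ^+ 2 + z 0 (j 4%N) ^+ 2)); rewrite ?addr_ge0 ?sqr_ge0 // -z2; ring.
  - by apply: (u1 _ (z 0 (j 2%N) ^+ 2 + z 0 (j 3%N) ^+ 2)); rewrite ?addr_ge0 ?sqr_ge0 // -z2; ring.
have K0 : (K !=set0)%classic.
  exists (\row_i ((i == j 0%N) || (i == j 2%N))%:R).
  by split; rewrite /nx /ny !mxE -!val_eqE /= !inordK //=; ring.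
have cK : compact K.
  apply: (@subclosed_compact _ K
     (fun z => forall i, z ord0 i \in `[-1, 1])).
  - apply: closedI.
      by move/continuous_closedP: cnx => /(_ [set 1]%classic); apply; apply: closed_eq.
    by move/continuous_closedP: cny => /(_ [set 1]%classic); apply; apply: closed_eq.
  - by apply: (@rV_compact R 5 (fun=> `[-1, 1]%classic)) => _; apply: segment_compact.
  - by move=> z /bnd.
have cF : continuous F.
  have c0 : continuous (fun _ : 'rV[R]_5 => 0 : R) by apply: cst_continuous.
  apply: (@q3_continuous _ (fun m z => q3 (c m) (z 0 (j 2%N)) (z 0 (j 3%N)) (z 0 (j 4%N)))) => //.
  move=> m; apply: (@q3_continuous _ (fun n _ => c m n)) => // n; exact: cst_continuous.
have [z /set_mem[nxz nyz] zmin] := EVT_min_rV K0 cK (continuous_subspaceT cF).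
pose y := v3 (z 0 (j 2%N)) (z 0 (j 3%N)) (z 0 (j 4%N)).
exists (F z), (z 0 (j 0%N)), (z 0 (j 1%N)), y; split=> //.
- rewrite v3_neq0; apply/negP => /and3P[/eqP e2 /eqP e3 /eqP e4].
  by move: nyz; rewrite /ny e2 e3 e4 !expr0n !addr0 => /eqP; rewrite eq_sym oner_eq0.
- by rewrite cE /y !v3E -/(ny z) nyz mulr1.
move=> x2 x3 y1 y2 y3; rewrite cE.
set p := x2 ^+ 2 + x3 ^+ 2; set q := y1 ^+ 2 + y2 ^+ 2 + y3 ^+ 2.
have p0 : 0 <= p by rewrite /p; nra.
have q0 : 0 <= q by rewrite /q; nra.
have [pz|pn0] := eqVneq p 0.
  have [-> ->] : x2 = 0 /\ x3 = 0 by split; move: pz; rewrite /p; nra.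
  by rewrite pz mulr0 mul0r /biq /q3; apply: eq_ge0 (lexx 0); ring.
have [qz|qn0] := eqVneq q 0.
  have [[-> ->] ->] : (y1 = 0 /\ y2 = 0) /\ y3 = 0 by split; [split|]; move: qz; rewrite /q; nra.
  by rewrite qz mulr0 /biq /q3; apply: eq_ge0 (lexx 0); ring.
(* Normalise x and y separately, f being homogeneous of degree 2 in each. *)
pose a := Num.sqrt p; pose b := Num.sqrt q.
have aE : a ^+ 2 = p by rewrite sqr_sqrtr.
have bE : b ^+ 2 = q by rewrite sqr_sqrtr.
have an0 : a != 0 by rewrite -sqrf_eq0 aE.
have bn0 : b != 0 by rewrite -sqrf_eq0 bE.
pose w : 'rV[R]_5 := \row_i nth 0 [:: x2 / a; x3 / a; y1 / b; y2 / b; y3 / b] i.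
have wE n : (n < 5)%N -> w 0 (j n) = nth 0 [:: x2 / a; x3 / a; y1 / b; y2 / b; y3 / b] n.
  by move=> n5; rewrite mxE inordK.
have Kw : K w.
  split; rewrite /nx /ny !wE //= !expr_div_n ?aE ?bE -!mulrDl ?mulfV //.
have abn0 : a ^+ 2 * b ^+ 2 > 0 by rewrite aE bE mulr_gt0 // lt0r ?pn0 ?qn0.
have -> : biq c 0 x2 x3 y1 y2 y3 = F w * (a ^+ 2 * b ^+ 2).
  rewrite /F !wE //= /biq /q3; field; exact/andP.
by rewrite -mulrA -aE -bE ler_pM2r // zmin // mem_set.
Qed.

(** Subtract t |x|^2 |y|^2, itself a sum of squares, with t the minimum on unit vectors. The
    remainder is nonnegative and has a zero, so [sos_2x3_zero] applies after a change of
    coordinates. *)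
Lemma sos_2x3 f : biform f ->
  (forall (x2 x3 : R) y, 0 <= f (v3 0 x2 x3) y) ->
  sos (fun x y : vec => f (v3 0 (x 0 i1) (x 0 i2)) y).
Proof.
move=> bf f0; have [t [a [b [y0 [ab y0n0 fmin tmin]]]]] := biform_min bf.
have t0 : 0 <= t.
  have := f0 a b y0; rewrite fmin pmulr_lge0 // lt0r; apply/andP; split.
    apply: contra y0n0 => /eqP e; apply/eqP; rewrite [y0]v3_eta.
    have [[-> ->] ->] : (y0 0 i0 = 0 /\ y0 0 i1 = 0) /\ y0 0 i2 = 0.
      by split; [split|]; move: e; nra.
    by apply/rowP => -[[|[|[|//]]] lt_i]; rewrite !mxE.
  by rewrite !addr_ge0 ?sqr_ge0.
pose n (x y : vec) := t * (x 0 i1 ^+ 2 + x 0 i2 ^+ 2) *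
   (y 0 i0 ^+ 2 + y 0 i1 ^+ 2 + y 0 i2 ^+ 2).
have ns : sos n.
  exists (fun xi : 'M[R]_3 => t * (xi i1 i0 ^+ 2 + xi i1 i1 ^+ 2 + xi i1 i2 ^+ 2 +
    xi i2 i0 ^+ 2 + xi i2 i1 ^+ 2 + xi i2 i2 ^+ 2)); split.
  - quadr.
  - by move=> xi; rewrite mulr_ge0 // !addr_ge0 ?sqr_ge0.
  - by move=> x y; rewrite !rank1E /n; ring.
have bn : biform n by have [q [qq _ qE]] := ns; exists q.
pose g (x y : vec) := f x y - n x y.
have bg : biform g by apply: biformB.
have g0 (x2 x3 : R) y : 0 <= g (v3 0 x2 x3) y.
  by rewrite subr_ge0 /n !v3E [y in f _ y]v3_eta.
(* The rotation P takes e2 to the minimising x = (0, a, b); S below takes e1 to the minimising y. *)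
pose P : 'M[R]_3 := \matrix_(i, k)
  (nth 0 (nth [::] [:: [:: 1; 0; 0]; [:: 0; a; b]; [:: 0; - b; a]] i) k).
have PE (x2 x3 : R) : v3 0 x2 x3 *m P = v3 0 (a * x2 - b * x3) (b * x2 + a * x3).
  by apply/rowP => -[[|[|[|//]]] lt_i]; rewrite !mxE sum3E !mxE /=; ring.
have a2 : a ^+ 2 = 1 - b ^+ 2 by rewrite -ab addrK.
have uP : P \in unitmx.
  pose P' : 'M[R]_3 := \matrix_(i, k)
    (nth 0 (nth [::] [:: [:: 1; 0; 0]; [:: 0; a; - b]; [:: 0; b; a]] i) k).
  have [] := @mulmx1_unit _ _ P P' _ => //.
  apply/matrixP => -[[|[|[|//]]] lt_i] -[[|[|[|//]]] lt_j];
    rewrite !mxE sum3E !mxE /=; ring: a2.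
have [S uS SE] := complete_row y0n0.
pose h (x y : vec) := g (v3 0 (x 0 i1) (x 0 i2)) y.
suff sh : sos h.
  apply: sos_ext (sosD ns sh) => x y; rewrite /h /g /n !v3E; ring.
apply: (@sos_coord _ _ P S uP uS).
have hE x y : h (x *m P) (y *m S) = g (v3 0 (x 0 i1) (x 0 i2) *m P) (y *m S).
  rewrite /h PE; congr (g (v3 _ _ _) _); rewrite !mxE sum3E !mxE /=; ring.
apply: sos_ext (@sos_2x3_zero (fun x y => g (x *m P) (y *m S)) _ _ _).
- by move=> x y; rewrite hE.
- exact: biform_coord.
- by move=> x2 x3 y; rewrite PE g0.
- by rewrite PE SE !(mulr0, subr0, addr0, mulr1) /g fmin /n !v3E ab; ring.
Qed.
End TwoByThree.

(** * Forms degenerate on a plane *)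

Section PlaneNormalForms.
Variable R : realType.
Local Notation vec := 'rV[R]_3.
Implicit Types (f g : vec -> vec -> R).

(** First-order conditions leave x1 only in the product x1 y3, with square coefficient k. Completing
    the square in x1 y3 yields a remainder free of x1, to which [sos_2x3] applies. *)
Lemma sos_common_kernel f : biform f -> psd f ->
  (forall y1 y2 : R, f (v3 1 0 0) (v3 y1 y2 0) = 0) -> sos f.
Proof.
move=> bf f0 fz; have [c cE] := biform_biq bf.
have q0 m : (forall y1 y2, q3 (c m) y1 y2 0 = 0) ->
    [/\ c m 0%N = 0, c m 1%N = 0 & c m 5%N = 0].
  move=> h; have := h 1 0; have := h 0 1; have := h 1 1; rewrite /q3.
  by split; lra.
have [c00 c01 c05] : [/\ c 0%N 0%N = 0, c 0%N 1%N = 0 & c 0%N 5%N = 0].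
  by apply: q0 => y1 y2; apply: etrans (fz y1 y2); rewrite cE /biq /q3; ring.
have [c50 c51 c55] : [/\ c 5%N 0%N = 0, c 5%N 1%N = 0 & c 5%N 5%N = 0].
  apply: q0 => y1 y2; apply: (@quad_nolin _ _ (q3 (c 1%N) y1 y2 0)) => t.
  apply: (eq_ge0 _ (f0 (v3 1 t 0) (v3 y1 y2 0))).
  by rewrite cE /biq /q3 c00 c01 c05; ring.
have [c40 c41 c45] : [/\ c 4%N 0%N = 0, c 4%N 1%N = 0 & c 4%N 5%N = 0].
  apply: q0 => y1 y2; apply: (@quad_nolin _ _ (q3 (c 2%N) y1 y2 0)) => t.
  apply: (eq_ge0 _ (f0 (v3 1 0 t) (v3 y1 y2 0))).
  by rewrite cE /biq /q3 c00 c01 c05; ring.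
have c04 : c 0%N 4%N = 0.
  apply: (@quad_nolin _ _ (c 0%N 2%N)) => t.
  apply: (eq_ge0 _ (f0 (v3 1 0 0) (v3 1 0 t))).
  by rewrite cE /biq /q3 c00 c01 c05; ring.
have c03 : c 0%N 3%N = 0.
  apply: (@quad_nolin _ _ (c 0%N 2%N)) => t.
  apply: (eq_ge0 _ (f0 (v3 1 0 0) (v3 0 1 t))).
  by rewrite cE /biq /q3 c00 c01 c05; ring.
pose k := c 0%N 2%N.
have k0 : 0 <= k.
  apply: (eq_ge0 _ (f0 (v3 1 0 0) (v3 0 0 1))).
  by rewrite cE /biq /q3 c00 c01 c05 /k; ring.
have klin (x2 x3 y1 y2 y3 : R) : k = 0 ->
    x2 * q3 (c 5%N) y1 y2 y3 + x3 * q3 (c 4%N) y1 y2 y3 = 0.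
  move=> kz; apply: (@affine_ge0 _ (biq c 0 x2 x3 y1 y2 y3)) => t.
  apply: (eq_ge0 _ (f0 (v3 t x2 x3) (v3 y1 y2 y3))).
  by rewrite cE /biq /q3 c00 c01 c05 c04 c03 -/k kz; ring.
have kh d : (k = 0 -> d = 0) -> exists e, d = 2 * k * e.
  have [-> dk|kn0 _] := eqVneq k 0; first by exists 0; rewrite dk // mulr0.
  by exists (d / (2 * k)); field.
have [e52 c52] : exists e, c 5%N 2%N = 2 * k * e.
  by apply: kh => kz; rewrite -(klin 1 0 0 0 1 kz) /q3; ring.
have [e42 c42] : exists e, c 4%N 2%N = 2 * k * e.
  by apply: kh => kz; rewrite -(klin 0 1 0 0 1 kz) /q3; ring.
have [e53 c53] : exists e, c 5%N 3%N = 2 * k * e.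
  apply: kh => kz; have := klin 1 0 0 1 1 kz; have := klin 1 0 0 0 1 kz.
  by rewrite /q3 c51; lra.
have [e43 c43] : exists e, c 4%N 3%N = 2 * k * e.
  apply: kh => kz; have := klin 0 1 0 1 1 kz; have := klin 0 1 0 0 1 kz.
  by rewrite /q3 c41; lra.
have [e54 c54] : exists e, c 5%N 4%N = 2 * k * e.
  apply: kh => kz; have := klin 1 0 1 0 1 kz; have := klin 1 0 0 0 1 kz.
  by rewrite /q3 c50; lra.
have [e44 c44] : exists e, c 4%N 4%N = 2 * k * e.
  apply: kh => kz; have := klin 0 1 1 0 1 kz; have := klin 0 1 0 0 1 kz.
  by rewrite /q3 c40; lra.
pose l (xi : 'M[R]_3) := xi i0 i2 + (e52 * xi i1 i2 + e53 * xi i1 i1 + e54 * xi i1 i0 +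
   e42 * xi i2 i2 + e43 * xi i2 i1 + e44 * xi i2 i0).
have sl : scalar l by move=> a u v; rewrite /l !mxE; ring.
pose g (x y : vec) := f x y - k * l (x^T *m y) ^+ 2.
have bg : biform g by apply/biformB/biform_sqr.
have gE (x1 x2 x3 y1 y2 y3 : R) :
    g (v3 x1 x2 x3) (v3 y1 y2 y3) = g (v3 0 x2 x3) (v3 y1 y2 y3).
  rewrite /g !cE /l !rank1E !v3E /biq /q3 c00 c01 c05 c04 c03.
  rewrite c50 c51 c55 c40 c41 c45 -/k c52 c42 c53 c43 c54 c44; ring.
have g0 (x2 x3 : R) y : 0 <= g (v3 0 x2 x3) y.
  have [d dE] := biform_biq bg.
  (* For y3 != 0 some x1 makes l vanish, and there g = f; y3 = 0 is a limit. *)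
  have pos (z2 z3 y1 y2 y3 : R) : y3 != 0 -> 0 <= g (v3 0 z2 z3) (v3 y1 y2 y3).
    move=> y3n0; rewrite -(gE (- (e52 * (z2 * y3) + e53 * (z2 * y2) + e54 * (z2 * y1) +
      e42 * (z3 * y3) + e43 * (z3 * y2) + e44 * (z3 * y1)) / y3)).
    rewrite /g [X in _ - k * X](_ : _ = 0) ?mulr0 ?subr0 ?f0 //.
    by rewrite /l !rank1E !v3E; field.
  rewrite [y]v3_eta; have [->|] := eqVneq (y 0 i2) 0; last exact: pos.
  apply: (@quad_near0 _ _ (q3 (fun m => d m 3%N * y 0 i1 + d m 4%N * y 0 i0) 0 x2 x3)
    (q3 (fun m => d m 2%N) 0 x2 x3)) => t t0.
  apply: (eq_ge0 _ (pos x2 x3 (y 0 i0) (y 0 i1) t (lt0r_neq0 t0))).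
  by rewrite !dE /biq /q3; ring.
apply: sos_ext (sosD (sos_sqr sl k0) (sos_2x3 bg g0)) => x y.
rewrite [y]v3_eta -(gE (x 0 i0)) -v3_eta -v3_eta /g; ring.
Qed.

(* On the plane y3 = 0 the form vanishes at x = (y1, y2, 0), so it is a
   quadratic form in x1y2 - x2y1, x3y1, x3y2, x1y3, x2y3, x3y3. These six
   products satisfy one quadratic relation G = 0, which they parametrize. *)
Lemma sos_linear_kernel f (Q : R -> R -> R -> R) : biform f -> psd f ->
  (exists a : nat -> R, forall w p p', Q w p p' = q3 a w p p') ->
  (forall x1 x2 x3 y1 y2 : R,
     f (v3 x1 x2 x3) (v3 y1 y2 0) = Q (x1 * y2 - x2 * y1) (x3 * y1) (x3 * y2)) ->
  sos f.
Proof.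
move=> bf f0 [a QE] fQ; have [c cE] := biform_biq bf.
have fE (x1 x2 x3 y1 y2 y3 : R) : f (v3 x1 x2 x3) (v3 y1 y2 y3) =
    Q (x1 * y2 - x2 * y1) (x3 * y1) (x3 * y2) +
    y3 * q3 (fun m => c m 3%N * y2 + c m 4%N * y1) x1 x2 x3 +
    y3 ^+ 2 * q3 (fun m => c m 2%N) x1 x2 x3.
  by rewrite -fQ !cE /biq /q3; ring.
have L0 (y1 y2 : R) : q3 (fun m => c m 3%N * y2 + c m 4%N * y1) y1 y2 0 = 0.
  apply: (@quad_nolin _ _ (q3 (fun m => c m 2%N) y1 y2 0)) => t.
  by apply: (eq_ge0 _ (f0 (v3 y1 y2 0) (v3 y1 y2 t))); rewrite fE QE /q3; ring.
have c04 : c 0%N 4%N = 0 by have := L0 1 0; rewrite /q3; lra.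
have c13 : c 1%N 3%N = 0 by have := L0 0 1; rewrite /q3; lra.
have c03 : c 0%N 3%N = - c 5%N 4%N.
  by have := L0 1 1; have := L0 1 (-1); rewrite /q3; lra.
have c14 : c 1%N 4%N = - c 5%N 3%N.
  by have := L0 1 1; have := L0 1 (-1); rewrite /q3; lra.
pose w (xi : 'M[R]_3) := xi i0 i1 - xi i1 i0.
(* By the four relations above, the part of the y3-linear term that involves only x1 and x2 is
   divisible by x1 y2 - x2 y1, which gives the second line. *)
pose F (xi : 'M[R]_3) := q3 a (w xi) (xi i2 i0) (xi i2 i1) +
  w xi * (c 5%N 3%N * xi i1 i2 - c 5%N 4%N * xi i0 i2) +
  (xi i2 i2 * (c 2%N 3%N * xi i2 i1 + c 2%N 4%N * xi i2 i0) +
   xi i1 i2 * (c 3%N 3%N * xi i2 i1 + c 3%N 4%N * xi i2 i0) +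
   xi i0 i2 * (c 4%N 3%N * xi i2 i1 + c 4%N 4%N * xi i2 i0)) +
  q3 (fun m => c m 2%N) (xi i0 i2) (xi i1 i2) (xi i2 i2).
pose G (xi : 'M[R]_3) :=
  xi i2 i0 * xi i1 i2 - xi i2 i1 * xi i0 i2 + xi i2 i2 * w xi.
have qF : quadratic F by rewrite /F /w /q3; quadr.
have qG : quadratic G by rewrite /G /w; quadr.
have FE (x1 x2 x3 y1 y2 y3 : R) (xi : 'M[R]_3) : w xi = x1 * y2 - x2 * y1 ->
    xi i2 i0 = x3 * y1 -> xi i2 i1 = x3 * y2 -> xi i0 i2 = x1 * y3 ->
    xi i1 i2 = x2 * y3 -> xi i2 i2 = x3 * y3 ->
    F xi = f (v3 x1 x2 x3) (v3 y1 y2 y3).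
  rewrite fE QE /F => -> -> -> -> -> ->.
  by rewrite /q3 c04 c13 c03 c14; ring.
have pos (xi : 'M[R]_3) : xi i2 i2 != 0 -> G xi = 0 -> 0 <= F xi.
  move=> r0 Gxi.
  rewrite (@FE (xi i0 i2) (xi i1 i2) (xi i2 i2) (xi i2 i0 / xi i2 i2)
    (xi i2 i1 / xi i2 i2) 1) ?mulr1 //; try by field.
  apply: (mulfI r0); apply/eqP; rewrite -subr_eq0 -[X in _ == X]Gxi; apply/eqP.
  by rewrite /G; field.
(* A zero of G with xi i2 i2 = 0 is approached along a line inside G = 0 on which that entry is t.
   The slope k is chosen to cancel the term t w in G, which needs one nonzero entry among the four
   others; if all four vanish, w alone is realised by x = e1. *)
have near (xi : 'M[R]_3) i j (k : R) : G xi = 0 -> xi i2 i2 = 0 -> (i, j) != (i2, i2) ->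
    (forall t, G (1 *: xi + t *: (k *: delta_mx i j + delta_mx i2 i2)) = 0) ->
    0 <= F xi.
  move=> Gxi r0 ij Gt.
  have [b Fb] := quadratic_line xi (k *: delta_mx i j + delta_mx i2 i2) qF.
  apply: (@quad_near0 _ _ b (F (k *: delta_mx i j + delta_mx i2 i2))) => t t0.
  apply: (eq_ge0 _ (pos (1 *: xi + t *: (k *: delta_mx i j + delta_mx i2 i2)) _ _)) => //.
    by rewrite Fb; ring.
  rewrite !mxE !eqxx r0 /=; move: ij; rewrite xpair_eqE ![i2 == _]eq_sym => /negPf->.
  by rewrite !mulr0 !add0r mulr1 gt_eqF.
have [||xi Gxi|l Fl] := S_lemma qF qG.
- by exists (delta_mx i0 i1 + delta_mx i2 i2); rewrite /G /w !mxE /=; lra.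
- by exists (delta_mx i1 i0 + delta_mx i2 i2); rewrite /G /w !mxE /=; lra.
- have [r0|r0] := eqVneq (xi i2 i2) 0; last exact: pos.
  have tac i j k t : G (1 *: xi + t *: (k *: delta_mx i j + delta_mx i2 i2)) - G xi = 0 ->
      G (1 *: xi + t *: (k *: delta_mx i j + delta_mx i2 i2)) = 0.
    by rewrite Gxi subr0.
  have [q'0|q'0] := eqVneq (xi i1 i2) 0; last first.
    apply: (near _ i2 i0 (- w xi / xi i1 i2)) => // t; apply: tac.
    by rewrite /G /w !mxE r0 /=; field.
  have [q0|q0] := eqVneq (xi i0 i2) 0; last first.
    apply: (near _ i2 i1 (w xi / xi i0 i2)) => // t; apply: tac.
    by rewrite /G /w !mxE r0 /=; field.
  have [p0|p0] := eqVneq (xi i2 i0) 0; last first.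
    apply: (near _ i1 i2 (- w xi / xi i2 i0)) => // t; apply: tac.
    by rewrite /G /w !mxE r0 /=; field.
  have [p'0|p'0] := eqVneq (xi i2 i1) 0; last first.
    apply: (near _ i0 i2 (w xi / xi i2 i1)) => // t; apply: tac.
    by rewrite /G /w !mxE r0 /=; field.
  by rewrite (@FE 1 0 0 0 (w xi) 0) ?r0 ?q'0 ?q0 ?p0 ?p'0; ring || apply: f0.
- exists (fun xi => F xi + l * G xi); split=> //.
    exact/quadraticD/quadraticZ.
  move=> x y; rewrite {1}[x]v3_eta {1}[y]v3_eta -(FE _ _ _ _ _ _ (x^T *m y)) ?/w ?rank1E //.
  by rewrite /G /w !rank1E; ring.
Qed.

(* Here the kernel is x = (y1^2, y2^2, y1y2). *)
Lemma sos_quadratic_kernel f (d : R) : biform f -> psd f -> `|d| < 1 ->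
  (forall x1 x2 x3 y1 y2 : R, f (v3 x1 x2 x3) (v3 y1 y2 0) =
     (x1 * y2 - x3 * y1) ^+ 2 + (x2 * y1 - x3 * y2) ^+ 2
     + 2 * d * ((x1 * y2 - x3 * y1) * (x2 * y1 - x3 * y2))) ->
  sos f.
Proof.
move=> bf f0 d1 fQ; have [c cE] := biform_biq bf.
have d2 : 0 < 1 - d ^+ 2.
  by move: d1; rewrite ltr_norml => /andP[? ?]; nra.
have fE (x1 x2 x3 y1 y2 y3 : R) : f (v3 x1 x2 x3) (v3 y1 y2 y3) =
    f (v3 x1 x2 x3) (v3 y1 y2 0) +
    y3 * q3 (fun m => c m 3%N * y2 + c m 4%N * y1) x1 x2 x3 +
    y3 ^+ 2 * q3 (fun m => c m 2%N) x1 x2 x3.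
  by rewrite !cE /biq /q3; ring.
have L0 (y1 y2 : R) :
    q3 (fun m => c m 3%N * y2 + c m 4%N * y1) (y1 ^+ 2) (y2 ^+ 2) (y1 * y2) = 0.
  apply: (@quad_nolin _ _ (q3 (fun m => c m 2%N) (y1 ^+ 2) (y2 ^+ 2) (y1 * y2))) => t.
  apply: (eq_ge0 _ (f0 (v3 (y1 ^+ 2) (y2 ^+ 2) (y1 * y2)) (v3 y1 y2 t))).
  by rewrite fE fQ /q3; ring.
(* [L0] is a binary quintic; six directions determine its six coefficients. *)
have [[c04 c13] [c14 c03] [c43 c34]] :
    [/\ c 0%N 4%N = 0 /\ c 1%N 3%N = 0,
       c 1%N 4%N = - c 3%N 3%N /\ c 0%N 3%N = - c 4%N 4%N &
       c 4%N 3%N = - (c 2%N 4%N + c 5%N 4%N) /\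
       c 3%N 4%N = - (c 2%N 3%N + c 5%N 3%N)].
  have := L0 1 0; have := L0 0 1; have := L0 1 1; have := L0 1 (-1).
  have := L0 1 2; have := L0 1 (-2); rewrite /q3.
  by split; split; lra.
pose l1 (x1 x2 x3 : R) := - c 4%N 4%N * x1 + c 5%N 3%N * x2 - c 2%N 4%N * x3.
pose l2 (x1 x2 x3 : R) := c 5%N 4%N * x1 + c 1%N 4%N * x2 - c 2%N 3%N * x3.
(* e is the scalar in the inverse of the matrix of 2 (u^2 + v^2 + 2 d u v). It turns the
   coefficients l1, l2 of the y3-linear part into the shifts m1, m2 that complete the square. *)
have [e eE] : exists e, 2 * (1 - d ^+ 2) * e = 1.
  by exists (2 * (1 - d ^+ 2))^-1; rewrite mulfV // mulf_neq0 ?gt_eqF.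
pose m1 x1 x2 x3 := e * (l1 x1 x2 x3 - d * l2 x1 x2 x3).
pose m2 x1 x2 x3 := e * (l2 x1 x2 x3 - d * l1 x1 x2 x3).
pose B1 (xi : 'M[R]_3) := xi i0 i1 - xi i2 i0 + m1 (xi i0 i2) (xi i1 i2) (xi i2 i2).
pose B2 (xi : 'M[R]_3) := xi i1 i0 - xi i2 i1 + m2 (xi i0 i2) (xi i1 i2) (xi i2 i2).
pose B (xi : 'M[R]_3) := B1 xi + d * B2 xi.
have sB2 : scalar B2 by move=> a u v; rewrite /B2 /m2 /l1 /l2 !mxE; ring.
have sB : scalar B.
  by move=> a u v; rewrite /B /B1 /m1 /B2 /m2 /l1 /l2 !mxE; ring.
pose g (x y : vec) := f x y - 1 * B (x^T *m y) ^+ 2 -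
   (1 - d ^+ 2) * B2 (x^T *m y) ^+ 2.
have bg : biform g by apply/biformB/biform_sqr/sB2/biformB/biform_sqr.
have [h hE] := biform_biq bg.
have l1E x1 x2 x3 : l1 x1 x2 x3 = 2 * (m1 x1 x2 x3 + d * m2 x1 x2 x3).
  rewrite (_ : l1 _ _ _ = 2 * (1 - d ^+ 2) * e * l1 x1 x2 x3) /m1 /m2; first by ring.
  by rewrite eE mul1r.
have l2E x1 x2 x3 : l2 x1 x2 x3 = 2 * (m2 x1 x2 x3 + d * m1 x1 x2 x3).
  rewrite (_ : l2 _ _ _ = 2 * (1 - d ^+ 2) * e * l2 x1 x2 x3) /m1 /m2; first by ring.
  by rewrite eE mul1r.
have LE (x1 x2 x3 y1 y2 : R) : q3 (fun m => c m 3%N * y2 + c m 4%N * y1) x1 x2 x3 =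
    l1 x1 x2 x3 * (x1 * y2 - x3 * y1) + l2 x1 x2 x3 * (x2 * y1 - x3 * y2).
  by rewrite /q3 /l1 /l2 c04 c13 c03 c14 c43 c34; ring.
have BE (x1 x2 x3 y1 y2 y3 : R) :
    (B1 ((v3 x1 x2 x3)^T *m v3 y1 y2 y3) = x1 * y2 - x3 * y1 + y3 * m1 x1 x2 x3) *
    (B2 ((v3 x1 x2 x3)^T *m v3 y1 y2 y3) = x2 * y1 - x3 * y2 + y3 * m2 x1 x2 x3).
  by rewrite /B1 /B2 !rank1E !v3E /m1 /m2 /l1 /l2; split; ring.
have gE (x1 x2 x3 y1 y2 y3 : R) : g (v3 x1 x2 x3) (v3 y1 y2 y3) =
    y3 ^+ 2 * q3 (fun m => h m 2%N) x1 x2 x3.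
  have -> : q3 (fun m => h m 2%N) x1 x2 x3 = g (v3 x1 x2 x3) (v3 0 0 1).
    by rewrite hE /biq /q3; ring.
  by rewrite /g /B !BE (fE _ _ _ y1 y2) (fE _ _ _ 0 0 1) !fQ !LE l1E l2E; ring.
have pos (x1 x2 x3 : R) : x3 ^+ 2 - x1 * x2 != 0 -> 0 <= q3 (fun m => h m 2%N) x1 x2 x3.
  move=> D0.
  (* With y3 = 1, Cramer's rule gives the y at which [B1] and [B2] both vanish; the determinant is
     x3^2 - x1 x2. *)
  pose u1 := m1 x1 x2 x3; pose u2 := m2 x1 x2 x3.
  have := gE x1 x2 x3 ((x3 * u1 + x1 * u2) / (x3 ^+ 2 - x1 * x2))
                     ((x3 * u2 + x2 * u1) / (x3 ^+ 2 - x1 * x2)) 1.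
  rewrite expr1n mul1r => <-; rewrite /g /B !BE.
  by apply: eq_ge0 (f0 _ _); rewrite -/u1 -/u2; field.
have h0 (x1 x2 x3 : R) : 0 <= q3 (fun m => h m 2%N) x1 x2 x3.
  have [D0|] := eqVneq (x3 ^+ 2 - x1 * x2) 0; last exact: pos.
  (* Moving x3 away from 0 by t makes x3^2 - x1 x2 equal to 2 t |x3| + t^2 > 0. *)
  pose s : R := if 0 <= x3 then 1 else -1.
  have [sx s2] : 0 <= s * x3 /\ s ^+ 2 = 1.
    rewrite /s; case: (lerP 0 x3) => h3; first by rewrite mul1r expr1n.
    by rewrite mulN1r sqrrN expr1n oppr_ge0 ltW.
  apply: (@quad_near0 _ _ (s * (2 * h 2%N 2%N * x3 + h 3%N 2%N * x2 + h 4%N 2%N * x1))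
     (h 2%N 2%N * s ^+ 2)) => t t0.
  apply: (eq_ge0 _ (pos x1 x2 (x3 + t * s) _)); first by rewrite /q3; ring.
  rewrite gt_eqF //; have -> : (x3 + t * s) ^+ 2 - x1 * x2 = 2 * t * (s * x3) + t ^+ 2.
    by apply: (addIr (- (x3 ^+ 2 - x1 * x2))); rewrite [in RHS]D0; ring: s2.
  by rewrite ltr_wpDl ?exprn_gt0 // mulr_ge0 // mulr_ge0 // ltW.
have hs : sos (fun x y : vec => y 0 i2 ^+ 2 * q3 (fun m => h m 2%N) (x 0 i0) (x 0 i1) (x 0 i2)).
  exists (fun xi : 'M[R]_3 => q3 (fun m => h m 2%N) (xi i0 i2) (xi i1 i2) (xi i2 i2)).
  split=> //; first by rewrite /q3; quadr.
  by move=> x y; rewrite !rank1E /q3; ring.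
apply: sos_ext (sosD (sosD (sos_sqr sB ler01) (sos_sqr sB2 (ltW d2))) hs) => x y.
have := gE (x 0 i0) (x 0 i1) (x 0 i2) (y 0 i0) (y 0 i1) (y 0 i2).
by rewrite -!v3_eta => <-; rewrite /g; ring.
Qed.
End PlaneNormalForms.

(** * Reduction to the normal forms on a plane *)

Section SingularPlane.
Variable R : realType.
Local Notation vec := 'rV[R]_3.
Implicit Types (f g : vec -> vec -> R).

Definition mx3 (a b c : vec) : 'M[R]_3 := \matrix_(i, j) nth 0 [:: a; b; c] i 0 j.

Lemma v3_mx3 (x1 x2 x3 a1 a2 a3 b1 b2 b3 c1 c2 c3 : R) :
  v3 x1 x2 x3 *m mx3 (v3 a1 a2 a3) (v3 b1 b2 b3) (v3 c1 c2 c3) =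
  v3 (x1 * a1 + x2 * b1 + x3 * c1) (x1 * a2 + x2 * b2 + x3 * c2)
     (x1 * a3 + x2 * b3 + x3 * c3).
Proof.
by apply/rowP => -[[|[|[|//]]] lt_i]; rewrite !mxE sum3E !mxE.
Qed.

Lemma mx3_unit (P P' : 'M[R]_3) :
  (forall x1 x2 x3 : R, v3 x1 x2 x3 *m P *m P' = v3 x1 x2 x3) -> P \in unitmx.
Proof.
move=> h; have [] // := @mulmx1_unit _ _ P P' _.
apply/row_matrixP => i; rewrite row1 rowE mulmxA.
by rewrite [delta_mx 0 i]v3_eta h.
Qed.

Lemma complete_rows2 (a b : vec) :
  (exists s t : R, (s != 0) || (t != 0) /\ s *: a + t *: b = 0) \/
  exists P : 'M[R]_3, [/\ P \in unitmx, v3 1 0 0 *m P = a & v3 0 1 0 *m P = b].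
Proof.
pose M : 'M[R]_(2, 3) := \matrix_(i, j) nth 0 [:: a; b] i 0 j.
have [rM|] := boolP (row_free M); last first.
  rewrite -kermx_eq0 => /rowV0Pn[u /sub_kermxP uM u0]; left.
  exists (u 0 ord0), (u 0 ord_max); split.
    rewrite -negb_and; apply: contra u0 => /andP[/eqP z0 /eqP z1].
    apply/eqP/rowP => i; rewrite mxE.
    by case: (unliftP ord0 i) => [k|] ->; rewrite ?z0 // -z1 ord1; congr (u 0 _); apply: val_inj.
  apply/rowP => j; have /rowP/(_ j) := uM.
  rewrite !mxE !big_ord_recl big_ord0 !mxE addr0 => <-.
  by congr (_ + u 0 _ * _); apply: val_inj.
right; pose E : 'M[R]_(2, 3) := pid_mx 2.
pose g := mx3 a b 0.
have gE (P : 'M[R]_3) i j : (E *m P) i j = P (widen_ord (isT : 2 <= 3)%N i) j.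
  rewrite mxE sum3E !mxE /=.
  by case: i => -[|[|//]] lt_i /=; rewrite ?(mul1r, mul0r, addr0, add0r);
    congr (P _ j); apply: val_inj.
have EgM : E *m g = M by apply/matrixP => -[[|[|//]] lt_i] j; rewrite gE !mxE.
have [|P uP PE] := @complete_unitmx R 2 3 E g.
  by rewrite EgM rank_pid_mx // (eqP rM).
exists P; split=> //.
- apply/rowP => j; have /matrixP/(_ ord0 j) := PE; rewrite EgM gE !mxE sum3E !mxE /= => ->.
  by rewrite mul1r !mul0r !addr0; congr (P _ j); apply: val_inj.
- apply/rowP => j; have /matrixP/(_ ord_max j) := PE; rewrite EgM gE !mxE sum3E !mxE /= => ->.
  by rewrite mul1r !mul0r add0r addr0; congr (P _ j); apply: val_inj.
Qed.

Lemma psd_coord f (P S : 'M[R]_3) : psd f -> psd (fun x y => f (x *m P) (y *m S)).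
Proof. by move=> f0 x y; apply: f0. Qed.

Lemma sos_kernel_vector f (a : vec) : biform f -> psd f -> a != 0 ->
  (forall y1 y2 : R, f a (v3 y1 y2 0) = 0) -> sos f.
Proof.
move=> bf f0 /complete_row[P uP PE] fa.
apply: (sos_coord uP (unitmx1 _ _)); apply: sos_common_kernel.
- exact: biform_coord.
- exact: psd_coord.
- by move=> y1 y2; rewrite PE mulmx1.
Qed.

Lemma biformZ f (s : R) x y : biform f -> f (s *: x) y = s ^+ 2 * f x y.
Proof.
move=> [q [b [bC blin qE]] fE].
have b0 w : b 0 w = 0 by have := blin 1 0 0 w; rewrite scale1r addr0; lra.
have bZ k w z : b (k *: w) z = k * b w z.
  by rewrite -[k *: w]addr0 blin b0 addr0.
by rewrite !fE linearZ -scalemxAl !qE bZ bC bZ; ring.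
Qed.

Lemma sos_mx3 f (P P' S S' : 'M[R]_3) :
  (forall x1 x2 x3 : R, v3 x1 x2 x3 *m P *m P' = v3 x1 x2 x3) ->
  (forall x1 x2 x3 : R, v3 x1 x2 x3 *m S *m S' = v3 x1 x2 x3) ->
  (biform (fun x y => f (x *m P) (y *m S)) -> psd (fun x y => f (x *m P) (y *m S)) ->
   sos (fun x y => f (x *m P) (y *m S))) ->
  biform f -> psd f -> sos f.
Proof.
move=> /mx3_unit uP /mx3_unit uS h bf f0; apply: (sos_coord uP uS).
by apply: h; [apply: biform_coord | apply: psd_coord].
Qed.

Lemma v3_1 (x1 x2 x3 : R) : v3 x1 x2 x3 *m (1%:M : 'M_3) *m (1%:M : 'M_3) = v3 x1 x2 x3.
Proof. by rewrite !mulmx1. Qed.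

(* The shape of f on the plane y3 = 0 when its kernels at (1, 0) and (0, 1) are
   spanned by e1 and e2: if the quadratic form below is definite, the kernel
   x(y) has degree 1 or 2 in y. *)
Lemma sos_definite_plane f (d p r : R) : biform f -> psd f -> `|d| < 1 ->
  (forall x1 x2 x3 y1 y2 : R, f (v3 x1 x2 x3) (v3 y1 y2 0) =
     (x1 * y2 + p * x3 * y1) ^+ 2 + (x2 * y1 + r * x3 * y2) ^+ 2
     + 2 * d * ((x1 * y2 + p * x3 * y1) * (x2 * y1 + r * x3 * y2))) ->
  sos f.
Proof.
move=> bf f0 d1 fE; have [p0|p0] := eqVneq p 0; have [r0|r0] := eqVneq r 0.
- apply: (@sos_kernel_vector _ (v3 0 0 1)) => //.
    by rewrite v3_neq0 oner_eq0 !andbF.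
  by move=> y1 y2; rewrite fE p0 r0; ring.
(* Substituting x = (x3, -x2, x1 / r) turns the two linear terms into x3 y2 and x1 y2 - x2 y1. *)
- apply: (@sos_mx3 f (mx3 (v3 0 0 r^-1) (v3 0 (-1) 0) (v3 1 0 0))
    (mx3 (v3 0 0 1) (v3 0 (-1) 0) (v3 r 0 0)) _ _ _ v3_1) => // [x1 x2 x3|bg g0].
    by rewrite !v3_mx3; congr v3; field.
  pose a n := nth 0 [:: 1; 0; 1; 0; 2 * d; 0] n.
  apply: (@sos_linear_kernel _ _ (q3 a)) => //; first by exists a.
  move=> x1 x2 x3 y1 y2; rewrite mulmx1 v3_mx3 fE p0 /q3 /a /=; field; exact: r0.
- apply: (@sos_mx3 f (mx3 (v3 1 0 0) (v3 0 0 (- p^-1)) (v3 0 1 0))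
    (mx3 (v3 1 0 0) (v3 0 0 1) (v3 0 (- p) 0)) _ _ _ v3_1) => // [x1 x2 x3|bg g0].
    by rewrite !v3_mx3; congr v3; field.
  pose a n := nth 0 [:: 1; 1; 0; 0; 0; 2 * d] n.
  apply: (@sos_linear_kernel _ _ (q3 a)) => //; first by exists a.
  move=> x1 x2 x3 y1 y2; rewrite mulmx1 v3_mx3 fE r0 /q3 /a /=; field; exact: p0.
(* Rescaling x2, x3 and y1 makes both p and r equal to -1. *)
- apply: (@sos_mx3 f (mx3 (v3 1 0 0) (v3 0 (p / r) 0) (v3 0 0 (- r^-1)))
    (mx3 (v3 1 0 0) (v3 0 (r / p) 0) (v3 0 0 (- r)))
    (mx3 (v3 (r / p) 0 0) (v3 0 1 0) (v3 0 0 1))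
    (mx3 (v3 (p / r) 0 0) (v3 0 1 0) (v3 0 0 1))) => // [x1 x2 x3|x1 x2 x3|bg g0].
  + by rewrite !v3_mx3; congr v3; field; rewrite ?p0 ?r0.
  + by rewrite !v3_mx3; congr v3; field; rewrite ?p0 ?r0.
  apply: (@sos_quadratic_kernel _ _ d) => // x1 x2 x3 y1 y2.
  rewrite !v3_mx3 [X in f _ (v3 _ _ X)](_ : _ = 0); last by ring.
  rewrite fE; field; exact/andP.
Qed.

(** First-order conditions at the two zeros leave, at x3 = 0, a quadratic form in A x1 y2 and B x2
    y1 with correlation d. If A or B is 0, a fixed vector is in every kernel; if |d| < 1 one
    completes squares and reaches [sos_definite_plane]; if |d| = 1 the form is a single square and
    the kernel is linear in y. *)
Lemma sos_independent_zeros f : biform f -> psd f ->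
  f (v3 1 0 0) (v3 1 0 0) = 0 -> f (v3 0 1 0) (v3 0 1 0) = 0 ->
  (forall y1 y2 : R, exists2 x, x != 0 & f x (v3 y1 y2 0) = 0) -> sos f.
Proof.
move=> bf f0 fz1 fz2 sing; have [c cE] := biform_biq bf.
have c00 : c 0%N 0%N = 0 by apply: etrans fz1; rewrite cE /biq /q3; ring.
have c11 : c 1%N 1%N = 0 by apply: etrans fz2; rewrite cE /biq /q3; ring.
have c50 : c 5%N 0%N = 0.
  apply: (@quad_nolin _ _ (c 1%N 0%N)) => t.
  by apply: (eq_ge0 _ (f0 (v3 1 t 0) (v3 1 0 0))); rewrite cE /biq /q3 c00; ring.
have c40 : c 4%N 0%N = 0.
  apply: (@quad_nolin _ _ (c 2%N 0%N)) => t.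
  by apply: (eq_ge0 _ (f0 (v3 1 0 t) (v3 1 0 0))); rewrite cE /biq /q3 c00; ring.
have c05 : c 0%N 5%N = 0.
  apply: (@quad_nolin _ _ (c 0%N 1%N)) => t.
  by apply: (eq_ge0 _ (f0 (v3 1 0 0) (v3 1 t 0))); rewrite cE /biq /q3 c00; ring.
have c51 : c 5%N 1%N = 0.
  apply: (@quad_nolin _ _ (c 0%N 1%N)) => t.
  by apply: (eq_ge0 _ (f0 (v3 t 1 0) (v3 0 1 0))); rewrite cE /biq /q3 c11; ring.
have c31 : c 3%N 1%N = 0.
  apply: (@quad_nolin _ _ (c 2%N 1%N)) => t.
  by apply: (eq_ge0 _ (f0 (v3 0 1 t) (v3 0 1 0))); rewrite cE /biq /q3 c11; ring.
have c15 : c 1%N 5%N = 0.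
  apply: (@quad_nolin _ _ (c 1%N 0%N)) => t.
  by apply: (eq_ge0 _ (f0 (v3 0 1 0) (v3 t 1 0))); rewrite cE /biq /q3 c11; ring.
have fE (x1 x2 x3 y1 y2 : R) : f (v3 x1 x2 x3) (v3 y1 y2 0) =
    c 0%N 1%N * (x1 * y2) ^+ 2 + c 1%N 0%N * (x2 * y1) ^+ 2 +
    c 5%N 5%N * (x1 * y2 * (x2 * y1)) +
    x3 * (x2 * y1 * (c 3%N 0%N * y1 + c 3%N 5%N * y2) +
          x1 * y2 * (c 4%N 1%N * y2 + c 4%N 5%N * y1)) +
    x3 ^+ 2 * q3 (c 2%N) y1 y2 0.
  by rewrite cE /biq /q3 c00 c11 c50 c40 c05 c51 c31 c15; ring.
have A0 : 0 <= c 0%N 1%N.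
  by apply: (eq_ge0 _ (f0 (v3 1 0 0) (v3 0 1 0))); rewrite fE; ring.
have B0 : 0 <= c 1%N 0%N.
  by apply: (eq_ge0 _ (f0 (v3 0 1 0) (v3 1 0 0))); rewrite fE; ring.
have [Az|An] := eqVneq (c 0%N 1%N) 0.
  apply: (@sos_kernel_vector _ (v3 1 0 0)) => //.
    by rewrite v3_neq0 oner_eq0.
  by move=> y1 y2; rewrite fE Az; ring.
have [Bz|Bn] := eqVneq (c 1%N 0%N) 0.
  apply: (@sos_kernel_vector _ (v3 0 1 0)) => //.
    by rewrite v3_neq0 oner_eq0 andbF.
  by move=> y1 y2; rewrite fE Bz; ring.
pose A := Num.sqrt (c 0%N 1%N); pose B := Num.sqrt (c 1%N 0%N).
have A2 : c 0%N 1%N = A ^+ 2 by rewrite sqr_sqrtr.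
have B2 : c 1%N 0%N = B ^+ 2 by rewrite sqr_sqrtr.
have An0 : A != 0 by rewrite -sqrf_eq0 -A2.
have Bn0 : B != 0 by rewrite -sqrf_eq0 -B2.
have AB0 : 0 < A * B by rewrite lt0r mulf_neq0 ?mulr_ge0 ?sqrtr_ge0.
have [d dE] : exists d, c 5%N 5%N = 2 * (A * B) * d.
  by exists (c 5%N 5%N / (2 * (A * B))); field; apply/andP.
(* The test point makes A x1 y2 and s B x2 y1 both equal to A B. *)
have dle (s : R) : s ^+ 2 = 1 -> 0 <= 1 + s * d.
  move=> s2; rewrite -(@pmulr_rge0 _ (2 * (A * B) ^+ 2)); last by rewrite mulr_gt0 ?exprn_gt0.
  apply: (eq_ge0 _ (f0 (v3 B (s * A) 0) (v3 1 1 0))).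
  by rewrite fE A2 B2 dE; ring: s2.
have d1 : `|d| <= 1.
  rewrite ler_norml; have := dle 1 (expr1n _ _); have := dle (-1).
  by rewrite sqrrN expr1n => /(_ erefl) h1 h2; apply/andP; split; lra.
have [p1 c45] : exists p, c 4%N 5%N = 2 * A * p by exists (c 4%N 5%N / (2 * A)); field.
have [r1 c41] : exists p, c 4%N 1%N = 2 * A * p by exists (c 4%N 1%N / (2 * A)); field.
have [p2 c30] : exists p, c 3%N 0%N = 2 * B * p by exists (c 3%N 0%N / (2 * B)); field.
have [r2 c35] : exists p, c 3%N 5%N = 2 * B * p by exists (c 3%N 5%N / (2 * B)); field.
have {}fE (x1 x2 x3 y1 y2 : R) : f (v3 x1 x2 x3) (v3 y1 y2 0) =
    (A * x1 * y2) ^+ 2 + (B * x2 * y1) ^+ 2 + 2 * d * (A * x1 * y2 * (B * x2 * y1)) +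
    2 * x3 * (B * x2 * y1 * (p2 * y1 + r2 * y2) + A * x1 * y2 * (r1 * y2 + p1 * y1)) +
    x3 ^+ 2 * q3 (c 2%N) y1 y2 0.
  by rewrite fE A2 B2 dE c45 c41 c30 c35; ring.
move: d1; rewrite le_eqVlt => /orP[/eqP d1|d1]; last first.
  have d2 : 0 < 1 - d ^+ 2 by move: d1; rewrite ltr_norml => /andP[? ?]; nra.
  have solve (a b : R) : exists u v, a = u + d * v /\ b = v + d * u.
    exists ((a - d * b) / (1 - d ^+ 2)), ((b - d * a) / (1 - d ^+ 2)).
    by split; field; rewrite gt_eqF.
  have [q1 [q2 [p1E p2E]]] := solve p1 p2; have [n1 [n2 [r1E r2E]]] := solve r1 r2.
  pose E (u v : R) := u ^+ 2 + v ^+ 2 + 2 * d * (u * v).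
  have EE u v : E u v = (u + d * v) ^+ 2 + (1 - d ^+ 2) * v ^+ 2 by rewrite /E; ring.
  have E0 u v : 0 <= E u v by rewrite EE addr_ge0 ?sqr_ge0 // mulr_ge0 ?sqr_ge0 // ltW.
  have Ez u v : E u v = 0 -> u = 0 /\ v = 0.
    move/eqP; rewrite EE paddr_eq0 ?sqr_ge0 ?(mulr_ge0 (ltW d2)) ?sqr_ge0 //.
    rewrite (mulf_eq0 (1 - d ^+ 2)) (gt_eqF d2) /= !sqrf_eq0 => /andP[/eqP u0 /eqP v0].
    by move: u0; rewrite v0 mulr0 addr0.
  pose D (y1 y2 : R) := q3 (c 2%N) y1 y2 0 - E (q1 * y1 + n1 * y2) (q2 * y1 + n2 * y2).
  have {}fE (x1 x2 x3 y1 y2 : R) : f (v3 x1 x2 x3) (v3 y1 y2 0) =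
      E (A * x1 * y2 + x3 * (q1 * y1 + n1 * y2)) (B * x2 * y1 + x3 * (q2 * y1 + n2 * y2)) +
      x3 ^+ 2 * D y1 y2.
    by rewrite fE p1E p2E r1E r2E /D /E; ring.
  (* Taking x3 = 1 and E = 0 shows D >= 0. At a kernel vector both summands then vanish, and x3 = 0
     would force x = 0. *)
  have D0 y1 y2 : y1 != 0 -> y2 != 0 -> D y1 y2 = 0.
    move=> y10 y20.
    have Dge : 0 <= D y1 y2.
      apply: (eq_ge0 _ (f0 (v3 (- (q1 * y1 + n1 * y2) / (A * y2))
                               (- (q2 * y1 + n2 * y2) / (B * y1)) 1) (v3 y1 y2 0))).
      by rewrite fE /E; field; rewrite An0 Bn0 y10 y20.
    have [x xn0] := sing y1 y2; rewrite [x]v3_eta fE => /eqP.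
    rewrite paddr_eq0 ?E0 ?(mulr_ge0 (sqr_ge0 _) Dge) //.
    rewrite (mulf_eq0 (x 0 i2 ^+ 2)) sqrf_eq0 => /andP[/eqP/Ez[u0 v0]].
    case/orP=> /eqP // x30; case/negP: xn0; apply/eqP; rewrite [x]v3_eta x30.
    move: u0 v0; rewrite x30 !mul0r !addr0 => /eqP u0 /eqP v0.
    move: u0; rewrite !mulf_eq0 (negPf An0) (negPf y20) orbF /= => /eqP->.
    move: v0; rewrite !mulf_eq0 (negPf Bn0) (negPf y10) orbF /= => /eqP->.
    by apply/rowP => -[[|[|[|//]]] lt_i]; rewrite !mxE.
  (* A binary quadratic form with zeros in three directions is zero. *)
  have {D0} D0 y1 y2 : D y1 y2 = 0.
    have n2n : (2 : R) != 0 by rewrite pnatr_eq0.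
    have := D0 1 1 (oner_neq0 _) (oner_neq0 _).
    have := D0 1 (-1) (oner_neq0 _); rewrite oppr_eq0 oner_neq0 => /(_ isT).
    have := D0 1 2 (oner_neq0 _) n2n; rewrite /D /E /q3 => h1 h2 h3.
    have [k0 [k1 k5]] : c 2%N 0%N = q1 ^+ 2 + q2 ^+ 2 + 2 * d * (q1 * q2) /\
       c 2%N 1%N = n1 ^+ 2 + n2 ^+ 2 + 2 * d * (n1 * n2) /\
       c 2%N 5%N = 2 * (q1 * n1) + 2 * (q2 * n2) + 2 * d * (q1 * n2 + q2 * n1).
      by split; [|split]; lra.
    by rewrite k0 k1 k5; ring.
  (* Rescale x1 and x2 and absorb into them the terms n1 x3 and q2 x3. *)
  apply: (@sos_mx3 f (mx3 (v3 A^-1 0 0) (v3 0 B^-1 0) (v3 (- (n1 / A)) (- (q2 / B)) 1))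
    (mx3 (v3 A 0 0) (v3 0 B 0) (v3 n1 q2 1)) _ _ _ v3_1) => // [x1 x2 x3|bg g0].
    by rewrite !v3_mx3; congr v3; field; rewrite An0 Bn0.
  apply: (@sos_definite_plane _ d q1 n2) => // x1 x2 x3 y1 y2.
  rewrite mulmx1 v3_mx3 fE D0 /E; field; exact/andP.
(* the semidefinite case, d = - s with s = 1 or s = -1 *)
have [s ds] : exists s, d = - s by exists (- d); rewrite opprK.
have s2 : s ^+ 2 = 1 by rewrite -sqrrN -ds -real_normK ?num_real // d1 expr1n.
(* The square vanishes at x = (y1 / A, s y2 / B, 0), so the term linear in x3 vanishes there too. *)
have lin (y1 y2 : R) : s * y2 * y1 * (p2 * y1 + r2 * y2) + y1 * y2 * (r1 * y2 + p1 * y1) = 0.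
  suff : 2 * (s * y2 * y1 * (p2 * y1 + r2 * y2) + y1 * y2 * (r1 * y2 + p1 * y1)) = 0 by lra.
  apply: (@quad_nolin _ _ (q3 (c 2%N) y1 y2 0)) => t.
  apply: (eq_ge0 _ (f0 (v3 (y1 / A) (s * y2 / B) t) (v3 y1 y2 0))).
  have e1 : A * (y1 / A) = y1 by field.
  have e2 : B * (s * y2 / B) = s * y2 by field.
  by rewrite fE e1 e2 ds; ring: s2.
have p2E : p2 = - s * p1.
  have sp : s * p2 = - p1 by have := lin 1 1; have := lin 1 (-1); lra.
  by rewrite mulNr -mulrN -sp; ring: s2.
have r2E : r2 = - s * r1.
  have sp : s * r2 = - r1 by have := lin 1 1; have := lin 1 (-1); lra.
  by rewrite mulNr -mulrN -sp; ring: s2.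
apply: (@sos_mx3 f (mx3 (v3 A^-1 0 0) (v3 0 (s / B) 0) (v3 (- (r1 / A)) (s * p1 / B) 1))
  (mx3 (v3 A 0 0) (v3 0 (s * B) 0) (v3 r1 (- p1) 1)) _ _ _ v3_1) => // [x1 x2 x3|bg g0].
  rewrite !v3_mx3; congr v3; try by field; rewrite An0 Bn0.
  have -> : forall u v w : R,
      (u * 0 + v * (s / B) + w * (s * p1 / B)) * (s * B) = s ^+ 2 * (v + w * p1).
    by move=> u v w; field.
  by rewrite s2; ring.
pose a n := nth 0 [:: 1; c 2%N 0%N - p1 ^+ 2; c 2%N 1%N - r1 ^+ 2; c 2%N 5%N - 2 * p1 * r1; 0; 0] n.
apply: (@sos_linear_kernel _ _ (q3 a)) => //; first by exists a.
move=> x1 x2 x3 y1 y2; rewrite mulmx1 v3_mx3.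
rewrite [X in f (v3 X _ _)](_ : _ = (x1 - r1 * x3) / A); last by field.
rewrite [X in f (v3 _ X _)](_ : _ = s * (x2 + p1 * x3) / B); last by field.
rewrite fE p2E r2E ds.
have e1 : A * ((x1 - r1 * x3) / A) = x1 - r1 * x3 by field.
have e2 : B * (s * (x2 + p1 * x3) / B) = s * (x2 + p1 * x3) by field.
rewrite e1 e2 /q3 /a /=; ring: s2.
Qed.

(** Take kernel vectors a at y = e1 and b at y = e2. If they are parallel, f(a, y) is a nonnegative
    binary form in y with two independent zeros, hence zero; otherwise they become e1 and e2. *)
Lemma sos_singular_plane f : biform f -> psd f ->
  (forall y1 y2 : R, exists2 x, x != 0 & f x (v3 y1 y2 0) = 0) -> sos f.
Proof.
move=> bf f0 sing.
have [a a0 fa] := sing 1 0; have [b b0 fb] := sing 0 1.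
have [[s [t [st dep]]]|[P [uP Pa Pb]]] := complete_rows2 a b.
- have [k kn0 bE] : exists2 k, k != 0 & b = k *: a.
    have sn0 : s != 0.
      apply/eqP => sz; move: st dep; rewrite sz eqxx scale0r add0r /= => tn0 /eqP.
      by rewrite scaler_eq0 (negPf tn0) (negPf b0).
    have tn0 : t != 0.
      apply/eqP => tz; move: dep; rewrite tz scale0r addr0 => /eqP.
      by rewrite scaler_eq0 (negPf sn0) (negPf a0).
    exists (- (s / t)); first by rewrite oppr_eq0 mulf_neq0 ?invr_eq0.
    apply: (scalerI tn0); rewrite scalerA mulrN mulrCA divff // mulr1 scaleNr.
    by apply/eqP; rewrite -addr_eq0 addrC dep.
  have fb' : f a (v3 0 1 0) = 0.
    move/eqP: fb; rewrite bE biformZ // mulf_eq0 sqrf_eq0 (negPf kn0) /=.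
    by move/eqP.
  apply: (sos_kernel_vector bf f0 a0).
  have [P uP Pa] := complete_row a0.
  have [c cE] := biform_biq (biform_coord P 1%:M bf).
  have faE (y1 y2 : R) : f a (v3 y1 y2 0) = q3 (c 0%N) y1 y2 0.
    by rewrite -Pa -[v3 y1 _ _]mulmx1 cE /biq /q3; ring.
  have c0 : c 0%N 0%N = 0 by rewrite -fa faE /q3; ring.
  have c1 : c 0%N 1%N = 0 by rewrite -fb' faE /q3; ring.
  have c5 : c 0%N 5%N = 0.
    apply: (@quad_nolin _ _ 0) => u; apply: (eq_ge0 _ (f0 a (v3 1 u 0))).
    by rewrite faE /q3 c0 c1; ring.
  by move=> y1 y2; rewrite faE /q3 c0 c1 c5; ring.
- apply: (sos_coord uP (unitmx1 _ _)).
  apply: sos_independent_zeros; rewrite ?Pa ?Pb ?mulmx1 //.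
  + exact: biform_coord.
  + move=> y1 y2; have [x x0 fx] := sing y1 y2.
    exists (x *m invmx P); last by rewrite mulmxKV // mulmx1.
    by apply: contra x0 => /eqP e; rewrite -(mulmxKV uP x) e mul0mx.
Qed.
End SingularPlane.

(** * Real cubics in two variables *)

Section Univariate.
Variable R : realType.
Implicit Types h d : {poly R}.

Lemma poly_nonroot d (e : R) : d != 0 -> 0 < e -> exists2 t, 0 < t <= e & d.[t] != 0.
Proof.
move=> d0 e0; pose rs := [seq e / n.+1%:R : R | n <- iota 0 (size d)].
have urs : uniq rs.
  rewrite map_inj_uniq ?iota_uniq // => m n /(mulfI (lt0r_neq0 e0))/invr_inj/eqP.
  by rewrite eqr_nat eqSS => /eqP.
have [/(max_poly_roots d0)/(_ urs)|] := boolP (all (root d) rs).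
  by rewrite size_map size_iota ltnn.
case/allPn => _ /mapP[n _ ->] rt; exists (e / n.+1%:R) => //.
rewrite divr_gt0 ?ltr0n //= ler_pdivrMr ?ltr0n //.
by rewrite -[leLHS]mulr1 ler_pM2l // ler1n.
Qed.

Lemma poly_eval0 h : (forall t, h.[t] = 0) -> h = 0.
Proof.
move=> h0; apply/eqP; apply: contraT => hn0.
by have [t _] := poly_nonroot hn0 ltr01; rewrite h0 eqxx.
Qed.

(** The roots of d are finite in number, so t is a limit of other points. Continuity takes the form
    h(t + u) = h(t) + u g(u) with g bounded for |u| <= 1. *)
Lemma poly_ge0_dense h d : d != 0 -> (forall t, d.[t] != 0 -> 0 <= h.[t]) ->
  forall t, 0 <= h.[t].
Proof.
move=> d0 hd t; pose k := h \Po ('X + t%:P).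
have kE u : k.[u] = h.[u + t] by rewrite horner_comp !hornerE.
have d'0 : d \Po ('X + t%:P) != 0 by rewrite comp_poly2_eq0 // size_XaddC.
have /factor_theorem[g gE] : root (k - k.[0]%:P) 0.
  by rewrite /root !hornerE subrr.
have {gE} kg u : k.[u] = k.[0] + u * g.[u].
  have /(congr1 (horner^~ u)) := gE; rewrite !hornerE subr0 [RHS]mulrC => <-; ring.
have [C gC] := poly_disk_bound g 1.
rewrite -[t]add0r -kE leNgt; apply/negP => k0.
have C0 : 0 <= C by apply: le_trans (gC 0 _); rewrite ?normr_ge0 // normr0.
pose e := Num.min 1 (- k.[0] / (2 * (C + 1))).
have e0 : 0 < e by rewrite lt_min ltr01 divr_gt0 ?oppr_gt0 // mulr_gt0 // ltr_wpDl.
have [u /andP[u0 ue] du] := poly_nonroot d'0 e0.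
have ku : 0 <= k.[u] by rewrite kE hd //; move: du; rewrite horner_comp !hornerE.
have [u1 ue'] : u <= 1 /\ u <= - k.[0] / (2 * (C + 1)).
  by move: ue; rewrite le_min => /andP[].
have ug : u * g.[u] <= u * C.
  by rewrite ler_pM2l // (le_trans (ler_norm _)) // gC // gtr0_norm.
move: ue'; rewrite ler_pdivlMr; last by rewrite mulr_gt0 // ltr_wpDl.
by move: ku; rewrite kg; nra.
Qed.

Lemma cubic_root (q : {poly R}) : q \is monic -> size q = 4%N -> exists t, q.[t] = 0.
Proof.
move=> qm q4; have q3 : q`_3 = 1 by move: qm; rewrite monicE /lead_coef q4 => /eqP.
have qE t : q.[t] = q`_0 + q`_1 * t + q`_2 * t ^+ 2 + t ^+ 3.
  by rewrite horner_coef q4 !big_ord_recr big_ord0 /= q3; ring.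
(* At M and -M the leading term outweighs the rest, so the signs differ. *)
pose M := 1 + `|q`_0| + `|q`_1| + `|q`_2|.
have M1 : 1 <= M by rewrite /M -!addrA lerDl !addr_ge0 ?normr_ge0.
have M0 : 0 <= M by apply: le_trans M1.
have bnd (c : R) k : (k <= 2)%N -> `|c * (- M) ^+ k| <= `|c| * M ^+ 2 /\
     `|c * M ^+ k| <= `|c| * M ^+ 2.
  move=> k2; rewrite !normrM !normrX normrN (ger0_norm M0).
  by split; rewrite ler_wpM2l ?normr_ge0 // ler_weXn2l.
have ME : M * M ^+ 2 = M ^+ 2 + `|q`_0| * M ^+ 2 + `|q`_1| * M ^+ 2 + `|q`_2| * M ^+ 2.
  by rewrite {1}/M; ring.
have M2 : 0 <= M ^+ 2 by rewrite exprn_ge0.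
have [a0 b0] := bnd q`_0 0%N isT; have [a1 b1] := bnd q`_1 1%N isT.
have [a2 b2] := bnd q`_2 2%N isT.
move: a0 b0 a1 b1 a2 b2; rewrite !ler_norml !expr0 !expr1 !mulr1.
move=> /andP[? ?] /andP[? ?] /andP[? ?] /andP[? ?] /andP[? ?] /andP[? ?].
have [||t _ /rootP] := @poly_ivt _ q (- M) M; last by exists t.
  by rewrite ge0_cp.
by rewrite !qE; apply/andP; split; lra.
Qed.

End Univariate.

(** * Common zeros and divisibility *)

Section Bivariate.
Variable R : realType.
Implicit Types p q P : {poly {poly R}}.

(** Polynomials over polynomials are read as polynomials in t over R[s], and [q.[t%:P].[s]] is the
    value at (s, t). Being monic in t keeps the degree under every specialisation of s. *)
Lemma monic_evalX q (s : R) : q \is monic -> size q = 4%N ->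
  (map_poly (horner_eval s) q \is monic) * (size (map_poly (horner_eval s) q) = 4%N).
Proof.
move=> qm q4; have lq : horner_eval s (lead_coef q) = 1.
  by rewrite (monicP qm) /horner_eval hornerE.
split; last by rewrite size_map_poly_id0 // lq oner_neq0.
apply/monicP; rewrite lead_coef_map_id0 // ?lq ?oner_neq0 //.
by rewrite /horner_eval horner0.
Qed.

Lemma eval2E q (s t : R) : q.[t%:P].[s] = (map_poly (horner_eval s) q).[t].
Proof.
rewrite -[RHS](_ : (map_poly (horner_eval s) q).[horner_eval s t%:P] = _).
  by rewrite horner_map.
by rewrite /horner_eval hornerC.
Qed.

Lemma monic_cubic_root q (s : R) : q \is monic -> size q = 4%N ->
  exists t : R, q.[t%:P].[s] = 0.
Proof.
move=> qm q4; have [m z] := monic_evalX s qm q4.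
by have [t t0] := cubic_root m z; exists t; rewrite eval2E.
Qed.

(** The rational root theorem over R[s]: the factor al t + be gives the root -be / al, and since q
    is monic this fraction is a polynomial. *)
Lemma linear_factor_root q (c : {poly R}) (b d : {poly {poly R}}) :
  q \is monic -> size q = 4%N -> c != 0 -> size d = 2%N -> c *: q = b * d ->
  exists r : {poly R}, q.[r] = 0.
Proof.
move=> qm q4 c0 d2 qbd.
have q3 : q`_3 = 1 by move: qm; rewrite monicE /lead_coef q4 => /eqP.
pose al := d`_1; pose be := d`_0.
have al0 : al != 0.
  have <- : lead_coef d = al by rewrite /lead_coef d2.
  by rewrite lead_coef_eq0 -size_poly_eq0 d2.
have dE : d = al%:P * 'X + be%:P.
  by rewrite -[LHS]coefK d2 poly_def !big_ord_recl big_ord0 /=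
    addr0 expr0 expr1 alg_polyC mul_polyC addrC.
have qE : q = 'X ^+ 3 + (q`_2)%:P * 'X ^+ 2 + (q`_1)%:P * 'X + (q`_0)%:P.
  rewrite -[LHS]coefK q4 poly_def !big_ord_recr big_ord0 /= q3 -!mul_polyC.
  ring.
(* This is al^3 q(-be / al), the remainder of al^3 q modulo d. A multiple of d of degree 0 in t must
   vanish. *)
pose rho := - be ^+ 3 + q`_2 * al * be ^+ 2 - q`_1 * al ^+ 2 * be + q`_0 * al ^+ 3.
have rho0 : rho = 0.
  pose g := (al ^+ 2)%:P * 'X ^+ 2 + (q`_2 * al ^+ 2 - al * be)%:P * 'X +
            (q`_1 * al ^+ 2 - q`_2 * al * be + be ^+ 2)%:P.
  have e : (c * rho)%:P = (al ^+ 3 *: b - c *: g) * d.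
    rewrite mulrBl -!scalerAl -qbd dE /g {1}qE /rho -!mul_polyC.
    by rewrite !(polyCM, polyCD, polyCN, rmorphXn) /=; ring.
  apply/eqP; apply: contraT => rn0.
  have crn0 : (c * rho)%:P != 0 :> {poly {poly R}} by rewrite polyC_eq0 mulf_neq0.
  have := size_polyC (c * rho); rewrite e in crn0 *.
  move: crn0; rewrite mulf_eq0 negb_or => /andP[h1 h2].
  rewrite size_mul // d2 addn2 /= mulf_neq0 //.
  by move/eqP; rewrite eqSS size_poly_eq0 (negPf h1).
pose g := gcdp al be; pose al' := al %/ g; pose be' := be %/ g.
have alE : al = al' * g by rewrite divpK // dvdp_gcdl.
have beE : be = be' * g by rewrite divpK // dvdp_gcdr.
have g0 : g != 0 by apply: contra al0 => /eqP e; rewrite alE e mulr0.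
have cop : coprimep al' be' by apply: coprimep_div_gcd; rewrite al0.
have b3 : be' ^+ 3 = al' * (q`_2 * be' ^+ 2 - q`_1 * al' * be' + q`_0 * al' ^+ 2).
  apply: (mulfI (expf_neq0 3 g0)); move: rho0; rewrite /rho alE beE => h.
  by apply/eqP; rewrite -subr_eq0 -oppr_eq0; apply/eqP; apply: etrans h; ring.
(* al' divides be'^3 and is coprime to it. *)
have /size_poly1P[k kn0 kE] : size al' == 1%N.
  have := coprimep_expr 3 cop; rewrite /coprimep => /eqP <-; apply/eqP/eqp_size.
  by rewrite eqp_sym dvdp_gcd_idl // b3 dvdp_mulr.
have [r rE] : exists r, be' = - (k%:P * r).
  exists ((- k^-1)%:P * be').
  by rewrite mulrA -polyCM mulrN mulfV // polyCN mulN1r opprK.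
exists r; apply: (mulfI (_ : (k%:P : {poly R}) ^+ 3 != 0)).
  by rewrite expf_neq0 // polyC_eq0.
rewrite mulr0 {1}qE !(hornerD, hornerM, hornerXn, hornerX, hornerC).
move/eqP: b3; rewrite rE kE -subr_eq0 => /eqP h.
apply/eqP; rewrite -oppr_eq0; apply/eqP; apply: etrans h; ring.
Qed.

(** The resultant in t lies in the ideal of q and P. For each s the cubic q has a real root t, where
    P vanishes too, so the resultant is 0 at every s. The common factor has degree 1 or 2 in t, and
    q has a linear factor, or degree 3, and q divides P. *)
Lemma cubic_linear_or_dvd q P : q \is monic -> size q = 4%N ->
  (forall s t : R, q.[t%:P].[s] = 0 -> P.[t%:P].[s] = 0) ->
  (exists r : {poly R}, q.[r] = 0) \/ exists a, P = a * q.
Proof.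
move=> qm q4 qP.
have [P1|P1] := leqP (size P) 1.
  right; exists 0; rewrite mul0r (size1_polyC P1); congr (_%:P).
  apply: poly_eval0 => s; have [t /qP] := monic_cubic_root s qm q4.
  by rewrite {1}(size1_polyC P1) hornerC.
have [/eqP|rn0] := boolP (resultant q P == 0); last first.
  have q1 : (1 < size q)%N by rewrite q4.
  have [[u v] _ /= e] := resultant_in_ideal q1 P1.
  case/negP: rn0; apply/eqP/poly_eval0 => s.
  have [t qt] := monic_cubic_root s qm q4.
  have /(congr1 (fun p => p.[t%:P].[s])) := e.
  by rewrite !hornerE qt (qP _ _ qt) !mulr0 addr0.
move/eqP; rewrite resultant_eq0; set d := gcdp q P => d1.
have qn0 : q != 0 by rewrite monic_neq0.
have dq : d %| q by apply: dvdp_gcdl.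
have d4 : (size d <= 4)%N by apply: leq_trans (dvdp_leq qn0 dq) _; rewrite q4.
have [[c b] /= c0 qbd] := Pdiv.WeakIdomain.dvdpP _ _ dq.
have [d2|dn2] := eqVneq (size d) 2%N.
  by left; apply: linear_factor_root qbd.
have [d3|dn3] := eqVneq (size d) 3%N.
  left; apply: (linear_factor_root (c := c) (b := d) (d := b)) => //; last by rewrite mulrC.
  have cq : c *: q != 0 by rewrite scale_poly_eq0 negb_or c0.
  have bn0 : b != 0 by apply: contra cq => /eqP e; rewrite qbd e mul0r.
  have dn0 : d != 0 by rewrite -size_poly_eq0 d3.
  by have := size_mul bn0 dn0; rewrite -qbd size_scale // q4 d3 addn3 /= => -[<-].
have dE : size d = size q.
  by move: d1 d4 dn2 dn3; rewrite q4; case: (size d) => [|[|[|[|[|]]]]].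
right; have : q %| P.
  have /eqP := dE; rewrite dvdp_size_eqp // => /andP[_ qd].
  by apply: dvdp_trans qd _; apply: dvdp_gcdr.
by move/(Pdiv.IdomainMonic.dvdpP qm).
Qed.
End Bivariate.

(** * Bounds on the total degree *)

Section Bidegree.
Variable R : realType.
Implicit Types p q P Q : {poly {poly R}}.

(* P has total degree at most n in its two variables, and l is the coefficient
   of the n-th power of the outer one. *)
Definition bideg (n : nat) P (l : R) : Prop :=
  (forall i, leq (size P`_i) (n.+1 - i)) /\ P`_n = l%:P.

Lemma bideg_size n P l : bideg n P l -> (size P <= n.+1)%N.
Proof.
move=> [h _]; apply/leq_sizeP => i ni; apply/eqP; rewrite -size_poly_eq0 -leqn0.
by apply: leq_trans (h i) _; rewrite leqn0 subn_eq0.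
Qed.

Lemma bidegM m n P Q k l : bideg m P k -> bideg n Q l -> bideg (m + n) (P * Q) (k * l).
Proof.
move=> [hP kP] [hQ lQ]; split=> [i|].
  rewrite coefM (leq_trans (size_sum _ _ _)) //; apply/bigmax_leqP => j _.
  have [->|P0] := eqVneq P`_j 0; first by rewrite mul0r size_poly0.
  have [->|Q0] := eqVneq Q`_(i - j) 0; first by rewrite mulr0 size_poly0.
  rewrite -size_poly_gt0 in P0; rewrite -size_poly_gt0 in Q0.
  rewrite size_mul -?size_poly_gt0 //.
  have bound a b u v : (0 < a -> 0 < b -> u < i.+1 -> a <= m.+1 - u ->
    b <= n.+1 - (i - u) -> v = (a + b).-1 -> v <= (m + n).+1 - i)%N by lia.
  exact: bound P0 Q0 (ltn_ord j) (hP j) (hQ (i - j)%N) erefl.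
rewrite coefM; have nm : (m < (m + n).+1)%N by rewrite ltnS leq_addr.
rewrite (bigD1 (Ordinal nm)) //= kP addKn lQ -polyCM big1 ?addr0 // => j jm.
have jmn : nat_of_ord j != m by apply: contra jm => /eqP e; apply/eqP/val_inj.
have [jlt|jgt|/eqP] := ltngtP j m; last by rewrite (negPf jmn).
  have Q0 : size Q`_(m + n - j) == 0%N by move: (hQ (m + n - j)%N); lia.
  by move: Q0; rewrite size_poly_eq0 => /eqP ->; rewrite mulr0.
have P0 : size P`_j == 0%N by move: (hP j); lia.
by move: P0; rewrite size_poly_eq0 => /eqP ->; rewrite mul0r.
Qed.

Lemma bidegD n P Q k l : bideg n P k -> bideg n Q l -> bideg n (P + Q) (k + l).
Proof.
move=> [hP kP] [hQ lQ]; split=> [i|]; last by rewrite coefD kP lQ polyCD.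
by rewrite coefD (leq_trans (size_polyD _ _)) // geq_max hP hQ.
Qed.

Lemma bidegC (c : R) : bideg 0 c%:P%:P c.
Proof.
split=> [[|i]|]; rewrite coefC //= ?size_poly0 //.
by rewrite size_polyC; case: eqP.
Qed.

Lemma bideg_linear (a b c : R) : bideg 1 ((a%:P + b *: 'X)%:P + c%:P *: 'X) c.
Proof.
split=> [i|]; rewrite coefD coefZ coefX coefC.
  case: i => [|[|i]] /=; rewrite ?(mulr0, addr0, add0r, mulr1) ?size_poly0 //.
    rewrite (leq_trans (size_polyD _ _)) // geq_max (leq_trans (size_polyC_leq1 _)) //=.
    by rewrite (leq_trans (size_scale_leq _ _)) ?size_polyX.
  by rewrite size_polyC_leq1.
by rewrite /= add0r mulr1.
Qed.

Lemma bidegX n P l k : bideg n P l -> bideg (n * k) (P ^+ k) (l ^+ k).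
Proof.
move=> h; elim: k => [|k IH]; first by rewrite muln0 !expr0; apply: bidegC.
by rewrite mulnS !exprS; apply: bidegM.
Qed.

(** If r had degree n >= 2, then r^3 of degree 3n would exceed the other terms, of degree at most 3,
    2 + n and 1 + 2n. *)
Lemma bideg_root q (l : R) (r : {poly R}) :
  bideg 3 q l -> q \is monic -> size q = 4%N -> q.[r] = 0 -> (size r <= 2)%N.
Proof.
move=> [h _] qm q4 qr; rewrite leqNgt; apply/negP => r3.
have q3 : q`_3 = 1 by move: qm; rewrite monicE /lead_coef q4 => /eqP.
have r0 : r != 0 by rewrite -size_poly_gt0; apply: leq_trans r3.
have e : r ^+ 3 = - (q`_0 + q`_1 * r + q`_2 * r ^+ 2).
  move: qr; rewrite horner_coef q4 !big_ord_recr big_ord0 /= q3 => e.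
  by apply/eqP; rewrite -subr_eq0; apply/eqP; apply: etrans e; ring.
have sX k : size (r ^+ k) = ((size r).-1 * k).+1.
  by rewrite -[in LHS](prednK (n := size (r ^+ k))) ?size_poly_gt0 ?expf_neq0 // size_exp.
have sM i k : (size (q`_i * r ^+ k)%R <= (4 - i) + (size r).-1 * k)%N.
  by rewrite (leq_trans (size_polyMleq _ _)) // sX addnS /= leq_add2r.
have := sX 3%N; rewrite e size_polyN.
have : (size (q`_0 + q`_1 * r + q`_2 * r ^+ 2)%R <=
    maxn (maxn 4 (3 + (size r).-1)) (2 + (size r).-1 * 2))%N.
  rewrite (leq_trans (size_polyD _ _)) // geq_max !leq_max; apply/andP; split.
    apply/orP; left; rewrite -leq_max (leq_trans (size_polyD _ _)) // geq_max !leq_max (h 0%N) /=.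
    by apply/orP; right; have := sM 1%N 1%N; rewrite expr1 muln1.
  by apply/orP; right; apply: sM.
by move: r3; case: (size r) => [|[|[|n]]] //= _ + e'; rewrite e'; lia.
Qed.

(* If q has no root r in R[s], then q divides every polynomial vanishing on the
   real curve q = 0; this applies to p and, as |p / q| <= |q|, also to p / q. *)
Lemma cubic_square_proportional q p (l k : R) :
  bideg 3 q l -> q \is monic -> size q = 4%N -> bideg 6 p k ->
  (forall s t : R, p.[t%:P].[s] ^+ 2 <= q.[t%:P].[s] ^+ 2 * p.[t%:P].[s]) ->
  (exists2 r : {poly R}, q.[r] = 0 & (size r <= 2)%N) \/
  exists k' : R, forall s t : R, p.[t%:P].[s] = k' * q.[t%:P].[s] ^+ 2.
Proof.
move=> hq qm q4 hp pq.
case: (@cubic_linear_or_dvd _ q p qm q4) => [s t e|[r qr]|[a pa]].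
- have := pq s t; rewrite e expr0n /= mul0r => p2.
  by apply/eqP; rewrite -sqrf_eq0 eq_le p2 sqr_ge0.
- by left; exists r => //; exact: bideg_root hq qm q4 qr.
case: (@cubic_linear_or_dvd _ q a qm q4) => [s t e|[r qr]|[b ab]].
- have [m z] := monic_evalX s qm q4.
  (* Where q != 0, the hypothesis with p = a q gives a^2 <= a q, hence a^2 <= q^2; by density this
     holds everywhere, so a vanishes where q does. *)
  have a0 u : 0 <= (map_poly (horner_eval s) (q ^+ 2 - a ^+ 2)).[u].
    apply: (@poly_ge0_dense _ _ (map_poly (horner_eval s) q)) => [|{}u].
      exact: monic_neq0.
    rewrite -!eval2E !hornerE => qn0.
    set A := a.[u%:P].[s]; set Q := q.[u%:P].[s] in qn0 *.
    have Q2 : 0 < Q ^+ 2 by rewrite lt0r sqrf_eq0 qn0 sqr_ge0.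
    have : Q ^+ 2 * A ^+ 2 <= Q ^+ 2 * (A * Q).
      by have := pq s u; rewrite pa !hornerM -/A -/Q exprMn [_ * Q ^+ 2]mulrC.
    rewrite ler_pM2l // => h; have := sqr_ge0 (Q - A); nra.
  have := a0 t; rewrite -eval2E !hornerE e expr0n /= sub0r oppr_ge0 => a2.
  by apply/eqP; rewrite -sqrf_eq0 eq_le a2 sqr_ge0.
- by left; exists r => //; exact: bideg_root hq qm q4 qr.
right; have qn0 : q != 0 by rewrite monic_neq0.
(* p has degree at most 6 in t, the degree of q^2, so b is free of t; the coefficient of t^6 in p is
   a constant, so b is free of s too. *)
have b1 : (size b <= 1)%N.
  have [->|b0] := eqVneq b 0; first by rewrite size_poly0.
  have bound n : (((n + 4).-1 + 4).-1 <= 7 -> n <= 1)%N by lia.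
  have := bideg_size hp; rewrite pa ab !size_mul ?mulf_neq0 // q4; exact: bound.
have [k' bE] : exists k' : R, b = k'%:P%:P.
  exists (b`_0)`_0; rewrite {1}(size1_polyC b1); congr _%:P.
  apply: size1_polyC; move: (hp.1 6%N).
  have q6 : (q * q)`_6 = 1.
    have qqm : q * q \is monic by rewrite monicMl.
    by have := monicP qqm; rewrite /lead_coef size_mul // q4.
  by rewrite pa ab {1}(size1_polyC b1) -mulrA mul_polyC coefZ q6 mulr1.
by exists k' => s t; rewrite pa ab bE !hornerM !hornerC; ring.
Qed.
End Bidegree.

(** * The determinant of the y-matrix *)

Section Forms.
Variable R : realType.
Local Notation vec := 'rV[R]_3.
Implicit Types p q : mpoly 3 R.

Definition ev (p : mpoly 3 R) (y : vec) : R := meval (fun j => y 0 j) p.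

Lemma rmorph_mmap (S : comNzRingType) (phi : {rmorphism S -> R})
    (h : {rmorphism R -> S}) (g : 'I_3 -> S) p :
  (forall a, phi (h a) = a) -> phi (mmap h g p) = meval (fun i => phi (g i)) p.
Proof.
move=> ph; rewrite mevalE /mmap rmorph_sum; apply: eq_bigr => m _.
rewrite rmorphM ph; congr (_ * _); rewrite /mmap1 rmorph_prod.
by apply: eq_bigr => i _; rewrite rmorphXn.
Qed.

Lemma ev_line p (y v : vec) : exists h : {poly R}, forall t, h.[t] = ev p (y + t *: v).
Proof.
exists (mmap (@polyC R) (fun i => (y 0 i)%:P + v 0 i *: 'X) p) => t.
rewrite -[LHS]/(horner_eval t _) rmorph_mmap; last by move=> a; apply: hornerC.
apply: meval_eq => i; rewrite /= /horner_eval !hornerE !mxE; ring.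
Qed.

(** Compare the coefficients of k^n in p(k y) = k^n p(y). Homogeneity is known only for values, and
    this yields it for monomials. *)
Lemma ev_homog_part p n : (forall k y, ev p (k *: y) = k ^+ n * ev p y) ->
  forall y, ev p y =
    \sum_(m <- msupp p | mdeg m == n) mcoeff m p * \prod_i y 0 i ^+ m i.
Proof.
move=> hp y.
pose h : {poly R} :=
  \sum_(m <- msupp p) (mcoeff m p * \prod_i y 0 i ^+ m i) *: 'X^(mdeg m) - ev p y *: 'X^n.
have h0 : h = 0.
  apply: poly_eval0 => k; rewrite /h hornerD hornerN hornerZ hornerXn.
  apply/eqP; rewrite subr_eq0 mulrC -hp /ev mevalE horner_sum; apply/eqP.
  apply: eq_bigr => m _; rewrite hornerZ hornerXn -mulrA; congr (_ * _).
  rewrite mdegE expr_sum -big_split /=; apply: eq_bigr => i _.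
  by rewrite mxE exprMn mulrC.
have := congr1 (fun g : {poly R} => g`_n) h0.
rewrite coef0 coefB coef_sum coefZ coefXn eqxx mulr1 => /eqP; rewrite subr_eq0 => /eqP <-.
rewrite [RHS]big_mkcond; apply: eq_bigr => m _.
by rewrite coefZ coefXn eq_sym; case: eqP; rewrite ?mulr1 ?mulr0.
Qed.

(** Dehomogenisation on the affine plane u1 + s u2 + t u0. The coefficient of t^n is the value at
    u0, so scaling that value to 1 makes P monic when n is its degree. *)
Lemma bideg_form p n (u0 u1 u2 : vec) : (forall k y, ev p (k *: y) = k ^+ n * ev p y) ->
  exists2 P : {poly {poly R}}, bideg n P (ev p u0) &
    forall s t, P.[t%:P].[s] = ev p (u1 + s *: u2 + t *: u0).
Proof.
move=> hp.
pose L (i : 'I_3) : {poly {poly R}} := ((u1 0 i)%:P + u2 0 i *: 'X)%:P + (u0 0 i)%:P *: 'X.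
exists (\sum_(m <- msupp p | mdeg m == n) (mcoeff m p)%:P%:P * \prod_i L i ^+ m i); last first.
  move=> s t; rewrite (ev_homog_part hp) !horner_sum; apply: eq_bigr => m _.
  rewrite !hornerM !hornerC !horner_prod; congr (_ * _); apply: eq_bigr => i _.
  rewrite !horner_exp; congr (_ ^+ _); rewrite /L !hornerE !mxE; ring.
rewrite (ev_homog_part hp).
elim: (msupp p) => [|m r IH].
  by rewrite !big_nil; split=> [i|]; rewrite coef0 ?size_poly0.
rewrite !big_cons; case: eqP => // mn; apply: bidegD => //.
have -> : n = (0 + (1 * m i0 + 1 * m i1 + 1 * m i2))%N.
  by rewrite -mn mdegE sum3E !mul1n.
apply: bidegM; first exact: bidegC.
rewrite !big_ord_recr !big_ord0 /= !mul1r.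
apply: bidegM; first apply: bidegM.
- rewrite (_ : widen_ord _ _ = i0); last exact: val_inj.
  exact/bidegX/bideg_linear.
- rewrite (_ : widen_ord _ _ = i1); last exact: val_inj.
  exact/bidegX/bideg_linear.
- rewrite (_ : ord_max = i2); last exact: val_inj.
  exact/bidegX/bideg_linear.
Qed.

(** On the line from y to y0 the polynomial q is not identically zero, so nonnegativity extends to y
    by [poly_ge0_dense]. *)
Lemma psd_dense (g : vec -> vec -> R) q (y0 : vec) : biform g -> ev q y0 != 0 ->
  (forall y, ev q y != 0 -> forall x, 0 <= g x y) -> psd g.
Proof.
move=> [f qf gE] q0 gq x y.
have [h hE] := ev_line q y (y0 - y).
have [c cE] := quadratic_line (x^T *m y) (x^T *m (y0 - y)) qf.
pose k : {poly R} := (f (x^T *m y))%:P + c *: 'X + f (x^T *m (y0 - y)) *: 'X^2.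
have kE t : k.[t] = g x (y + t *: (y0 - y)).
  rewrite gE mulmxDr -scalemxAr -[x^T *m y]scale1r cE /k.
  rewrite !(hornerD, hornerC, hornerZ, hornerX, hornerXn); ring.
have hn0 : h != 0.
  apply: contra q0 => /eqP hz; have := hE 1; rewrite hz horner0 scale1r.
  by rewrite addrC subrK => <-.
have := @poly_ge0_dense _ k h hn0 _ 0; rewrite kE scale0r addr0; apply => t.
by rewrite hE kE => /gq; apply.
Qed.
End Forms.

(** * Forms whose determinant is a square *)

Section Assembly.
Variable R : realType.
Local Notation vec := 'rV[R]_3.

Lemma det3E (A : 'M[R]_3) : \det A =
  A i0 i0 * (A i1 i1 * A i2 i2 - A i1 i2 * A i2 i1) -
  A i0 i1 * (A i1 i0 * A i2 i2 - A i1 i2 * A i2 i0) +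
  A i0 i2 * (A i1 i0 * A i2 i1 - A i1 i1 * A i2 i0).
Proof.
rewrite (expand_det_row _ i0) sum3E /cofactor !minorE !lift3E /=.
rewrite addn0 addn1 addn2 expr0 expr1 sqrrN expr1n; ring.
Qed.

(** The matrix determinant lemma with the adjugate in place of the inverse, so that A may be
    singular. *)
Lemma det_rank_one_update (A : 'M[R]_3) (b : vec) (c : R) :
  \det (A - c *: (b^T *m b)) = \det A - c * (b *m \adj A *m b^T) 0 0.
Proof.
rewrite mxE sum3E !mxE !sum3E !mxE /cofactor !minorE !lift3E !det3E !mxE !big_ord1 !mxE /=.
rewrite !exprS !expr0; ring.
Qed.

Section ZeroDet.
Variable C : tensor4 R.
Local Notation f := (fun x y : vec => quad_form C (x^T *m y)).
Local Notation T y := (eval_ymatrix (ymatrix C) y).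

Lemma tensor_biform : biform f.
Proof. by exists (quad_form C) => //; apply: quad_form_quadratic. Qed.

Lemma tensor_ymatrix (x y : vec) : f x y = (x *m T y *m x^T) 0 0.
Proof. by have [_ _ ->] := ymatrix_spec C. Qed.

Lemma ymatrix_sym (y : vec) : (T y)^T = T y.
Proof.
have [sT _ _] := ymatrix_spec C.
by rewrite -[in RHS]sT /eval_ymatrix matrix.map_trmx.
Qed.

Lemma ymatrixE (y : vec) i k :
  T y i k = \sum_j \sum_l (C i j k l + C k j i l) / 2 * (y 0 j * y 0 l).
Proof.
rewrite !mxE raddf_sum; apply: eq_bigr => j _.
rewrite raddf_sum; apply: eq_bigr => l _.
by rewrite /= mevalZ mevalM !mevalXU.
Qed.

Lemma ymatrixZ k (y : vec) : T (k *: y) = k ^+ 2 *: T y.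
Proof.
apply/matrixP => i j; rewrite [RHS]mxE !ymatrixE mulr_sumr; apply: eq_bigr => a _.
by rewrite mulr_sumr; apply: eq_bigr => b _; rewrite !mxE; ring.
Qed.

Lemma sos_det_plane (P : 'M[R]_3) : psd f -> P \in unitmx ->
  (forall y1 y2 : R, \det (T (v3 y1 y2 0 *m P)) = 0) -> sos f.
Proof.
move=> f0 uP dP; apply: (sos_coord (unitmx1 _ _) uP).
apply: sos_singular_plane.
- exact: biform_coord tensor_biform.
- by move=> x y; apply: f0.
move=> y1 y2; have /eqP/det0P[v v0 vT] := dP y1 y2.
exists v => //; rewrite mulmx1.
by have := tensor_ymatrix v (v3 y1 y2 0 *m P); rewrite /= vT mul0mx mxE.
Qed.

Section SquareDet.
Variables (q : mpoly 3 R) (B : 'M[R]_3).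
Hypothesis f_psd : psd f.
Hypothesis fB_psd : psd (fun x y => f x y - rank_one_form B (x^T *m y)).
Hypothesis det_square : forall y, \det (T y) = ev q y ^+ 2.

Let b (y : vec) : vec := y *m B^T.
(** Where T(y) is invertible this is det T(y) times b T(y)^-1, the direction in x along which f is
    minimised in order to subtract a multiple of (x b^T)^2. *)
Let z (y : vec) : vec := b y *m \adj (T y).
Let p (y : vec) : R := (z y *m (b y)^T) 0 0.
Let xb (x y : vec) : R := (x *m (b y)^T) 0 0.

Lemma rank_one_formE (x y : vec) : rank_one_form B (x^T *m y) = xb x y ^+ 2.
Proof.
rewrite /rank_one_form /xb /b trmx_mul trmxK mxE; congr (_ ^+ 2); apply: eq_bigr => i _.
rewrite mxE mulr_sumr; apply: eq_bigr => j _; rewrite rank1E mxE; ring.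
Qed.

Lemma z_ymatrix y : z y *m T y = ev q y ^+ 2 *: b y.
Proof. by rewrite -mulmxA mul_adj_mx mul_mx_scalar det_square. Qed.

Lemma line_z (x y : vec) t :
  f (x + t *: z y) y = f x y + t * (2 * ev q y ^+ 2 * xb x y) + t ^+ 2 * (ev q y ^+ 2 * p y).
Proof.
have tr1 (u v : vec) : (u *m v^T) 0 0 = (v *m u^T) 0 0.
  by rewrite -[u *m v^T]trmxK mxE trmx_mul trmxK.
have xz : (x *m T y *m (z y)^T) 0 0 = ev q y ^+ 2 * xb x y.
  rewrite -mulmxA -[T y in LHS]ymatrix_sym -trmx_mul z_ymatrix linearZ -scalemxAr /=.
  by rewrite mxE.
have zx : (z y *m T y *m x^T) 0 0 = ev q y ^+ 2 * xb x y.
  by rewrite z_ymatrix -scalemxAl mxE tr1.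
have zz : (z y *m T y *m (z y)^T) 0 0 = ev q y ^+ 2 * p y.
  by rewrite z_ymatrix -scalemxAl mxE tr1.
have := tensor_ymatrix (x + t *: z y) y; have := tensor_ymatrix x y => /= -> ->.
rewrite [(x + _)^T]linearD linearZ /= !mulmxDl !mulmxDr -!scalemxAl -!scalemxAr.
have aE (M N : 'M[R]_1) : (M + N) 0 0 = M 0 0 + N 0 0 by rewrite mxE.
have sE k (M : 'M[R]_1) : (k *: M) 0 0 = k * M 0 0 by rewrite mxE.
by rewrite !(aE, sE) xz zx zz; ring.
Qed.

(** At x = z the form f equals q^2 p and the rank-one form equals p^2. *)
Lemma p_sqr_le y : p y ^+ 2 <= ev q y ^+ 2 * p y.
Proof.
have := fB_psd (z y) y; rewrite /= rank_one_formE subr_ge0 => /le_trans; apply.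
have := line_z 0 y 1; rewrite !scale1r add0r /= => ->.
have -> : xb 0 y = 0 by rewrite /xb mul0mx mxE.
have := tensor_ymatrix 0 y => /= ->; rewrite mul0mx mul0mx mxE; lra.
Qed.

Lemma p_homog k y : p (k *: y) = k ^+ 6 * p y.
Proof.
have bZ : b (k *: y) = k *: b y by rewrite /b -scalemxAl.
rewrite /p /z bZ ymatrixZ adjZ [(k *: _)^T]linearZ /= -!scalemxAr -!scalemxAl.
by rewrite !scalerA [LHS]mxE; congr (_ * _); ring.
Qed.

(** The determinant has degree 6, so q(t y)^2 = (t^3 q(y))^2 for all t. One of the factors of this
    difference of squares is zero as a polynomial in t; for the wrong sign, t = 1 gives q(y) = 0. *)
Lemma q_homog k y : ev q (k *: y) = k ^+ 3 * ev q y.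
Proof.
have [h hE] := ev_line q 0 y.
have {}hE t : h.[t] = ev q (t *: y) by rewrite hE add0r.
have h1 : h.[1] = ev q y by rewrite hE scale1r.
have : (h - ev q y *: 'X^3) * (h + ev q y *: 'X^3) = 0.
  apply: poly_eval0 => t; rewrite !(hornerXn, hornerM, hornerD, hornerN, hornerZ) hE.
  have := det_square (t *: y); rewrite ymatrixZ detZ det_square => e.
  have -> : forall u v : R, (u - v) * (u + v) = u ^+ 2 - v ^+ 2 by move=> u v; ring.
  by rewrite -e; ring.
move/eqP; rewrite mulf_eq0 subr_eq0 addr_eq0 => /orP[/eqP e|/eqP e].
  by rewrite -hE e hornerZ hornerXn mulrC.
have q0 : ev q y = 0.
  by have := h1; rewrite e hornerN hornerZ hornerXn expr1n; lra.
by rewrite -hE e q0 scale0r oppr0 horner0 mulr0.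
Qed.

Lemma p_poly : exists pm : mpoly 3 R, forall y, ev pm y = p y.
Proof.
pose bm : 'M[mpoly 3 R]_(1, 3) :=
  \row_i \sum_j (B i j) *: mpolyX R (mnm1 j).
exists ((bm *m \adj (ymatrix C) *m bm^T) 0 0) => y.
have bE : map_mx (meval (fun j => y 0 j)) bm = b y.
  apply/rowP => i; rewrite !mxE raddf_sum; apply: eq_bigr => j _.
  by rewrite /= mevalZ mevalXU mxE mulrC.
transitivity ((map_mx (meval (fun j => y 0 j)) (bm *m \adj (ymatrix C) *m bm^T)) 0 0);
  first by rewrite [RHS]mxE.
by rewrite !map_mxM map_mx_adj -matrix.map_trmx bE.
Qed.

(** If k = 0, then f is affine along z, which forces B = 0. If k > 0, subtracting the rank-one form
    divided by k leaves a nonnegative form whose y-matrix has determinant q^2 - p / k = 0, so that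
    [sos_singular_plane] applies. *)
Lemma sos_proportional k (y0 : vec) : B != 0 -> ev q y0 != 0 ->
  (forall y, p y = k * ev q y ^+ 2) -> sos f.
Proof.
move=> B0 q0 pk; have bf := tensor_biform.
have Q0 y : ev q y != 0 -> 0 < ev q y ^+ 2.
  by move=> qy; rewrite lt0r sqrf_eq0 qy sqr_ge0.
have bR c : biform (fun x y => c * rank_one_form B (x^T *m y)).
  exists (fun xi => c * rank_one_form B xi) => //; apply/quadraticZ/quadraticM;
    move=> s u v; rewrite mulr_sumr -big_split; apply: eq_bigr => i _;
    rewrite mulr_sumr -big_split; apply: eq_bigr => j _; rewrite !mxE /=; ring.
have k0 : 0 <= k.
  have := p_sqr_le y0; rewrite pk => h.
  rewrite -(pmulr_rge0 _ (mulr_gt0 (Q0 _ q0) (Q0 _ q0))).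
  apply: le_trans (sqr_ge0 (k * ev q y0 ^+ 2)) _; apply: le_trans h _.
  by rewrite le_eqVlt; apply/orP; left; apply/eqP; ring.
have [kz|kn0] := eqVneq k 0.
  have := @psd_dense _ (fun x y => -1 * rank_one_form B (x^T *m y)) q y0 (bR _) q0.
  have xb0 y : ev q y != 0 -> forall x, 0 <= -1 * rank_one_form B (x^T *m y).
    move=> qy x; rewrite rank_one_formE.
    have /eqP : 2 * ev q y ^+ 2 * xb x y = 0.
      apply: (@affine_ge0 _ (f x y)) => t; apply: (eq_ge0 _ (f_psd (x + t *: z y) y)).
      by rewrite line_z pk kz; ring.
    have n0 : 2 * ev q y ^+ 2 != 0 by rewrite mulf_neq0 ?pnatr_eq0 ?sqrf_eq0.
    rewrite mulf_eq0 (negPf n0) => /eqP ->.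
    by rewrite expr0n /= mulr0.
  move=> /(_ xb0) h; case/eqP: B0; apply/matrixP => i j; rewrite mxE.
  have := h (delta_mx 0 i) (delta_mx 0 j).
  have -> : rank_one_form B ((delta_mx 0 i : vec)^T *m (delta_mx 0 j : vec)) = B i j ^+ 2.
    by rewrite rank_one_formE /xb /b -!rowE !mxE.
  by rewrite mulN1r oppr_ge0 => h'; apply/eqP; rewrite -sqrf_eq0 eq_le h' sqr_ge0.
have {k0} k0 : 0 < k by rewrite lt0r kn0.
pose g (x y : vec) := f x y - k^-1 * rank_one_form B (x^T *m y).
have bg : biform g by apply: biformB.
have g0 : psd g.
  apply: (psd_dense bg q0) => y qy x.
  (* This multiple of z minimises f on the line, and the minimum is g. *)
  apply: (eq_ge0 _ (f_psd (x + (- xb x y / (k * ev q y ^+ 2)) *: z y) y)).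
  rewrite line_z pk /g rank_one_formE; field; rewrite kn0; exact: qy.
have gs : sos g.
  apply: sos_singular_plane => // y1 y2; set y := v3 y1 y2 0.
  have /eqP/det0P[v v0 vM] : \det (T y - k^-1 *: ((b y)^T *m b y)) = 0.
    by rewrite det_rank_one_update det_square -/(z y) -/(p y) pk mulKf ?subrr.
  exists v => //; rewrite /g rank_one_formE.
  have := tensor_ymatrix v y => /= ->.
  have /eqP := vM; rewrite mulmxBr -scalemxAr subr_eq0 => /eqP ->.
  have e (u w : vec) : (v *m (u^T *m w) *m v^T) 0 0 = (v *m u^T) 0 0 * (w *m v^T) 0 0.
    by rewrite mulmxA -(mulmxA (v *m u^T)) [LHS]mxE big_ord1.
  rewrite -scalemxAl [X in X - _]mxE e.
  have tr1 : (b y *m v^T) 0 0 = (v *m (b y)^T) 0 0.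
    by rewrite -[b y *m v^T]trmxK mxE trmx_mul trmxK.
  by rewrite tr1 /xb; ring.
apply: sos_ext (sosD gs (sos_sqr (l := fun xi => \sum_i \sum_j B i j * xi i j) (k := k^-1) _ _)).
- by move=> x y; rewrite /g /rank_one_form; ring.
- move=> s u v; rewrite mulr_sumr -big_split; apply: eq_bigr => i _;
    rewrite mulr_sumr -big_split; apply: eq_bigr => j _; rewrite !mxE /=; ring.
- by rewrite invr_ge0 ltW.
Qed.

Lemma eval_limit (h : {poly R}) : (forall t, t != 0 -> h.[t] = 0) -> h.[0] = 0.
Proof.
move=> h0; suff /eqP : 'X * h = 0.
  by rewrite mulf_eq0 polyX_eq0 /= => /eqP ->; rewrite horner0.
apply: poly_eval0 => t; rewrite hornerM hornerX.
by have [->|/h0 ->] := eqVneq t 0; rewrite ?mul0r ?mulr0.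
Qed.

(** In coordinates with q(y0) != 0 as leading coefficient, q becomes a monic cubic in t. By
    [cubic_square_proportional] either q vanishes on a plane, or p is a multiple of q^2. *)
Lemma sos_square_det : B != 0 -> sos f.
Proof.
move=> B0; have [[y0 q0]|qz] := EM (exists y, ev q y != 0); last first.
  apply: (sos_det_plane f_psd (unitmx1 _ _)) => y1 y2; rewrite det_square.
  apply/eqP; rewrite sqrf_eq0; apply: contra_notT qz => h; by exists (v3 y1 y2 0 *m 1%:M).
have [pm pmE] := p_poly.
have y00 : y0 != 0.
  apply: contra q0 => /eqP ->; have := q_homog 0 0.
  by rewrite scale0r expr0n mul0r => ->.
have [S uS SE] := complete_row y00.
pose u1 := v3 0 1 0 *m S; pose u2 := v3 0 0 1 *m S.
have vS a c d : v3 a c d *m S = a *: y0 + c *: u1 + d *: u2.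
  rewrite -SE /u1 /u2 !scalemxAl -!mulmxDl; congr (_ *m S).
  by apply/rowP => -[[|[|[|//]]] lt_i]; rewrite !mxE /=; ring.
pose c0 := ev q y0.
have q1E y : ev (c0^-1 *: q) y = c0^-1 * ev q y by rewrite /ev mevalZ.
have p1E y : ev (c0 ^- 2 *: pm) y = c0 ^- 2 * p y by rewrite /ev mevalZ -/(ev pm y) pmE.
have [|Q hQ QE] := @bideg_form _ (c0^-1 *: q) 3 y0 u1 u2.
  by move=> k y; rewrite !q1E q_homog; ring.
have [|P hP PE] := @bideg_form _ (c0 ^- 2 *: pm) 6 y0 u1 u2.
  by move=> k y; rewrite !p1E p_homog; ring.
rewrite q1E mulVf // in hQ.
have Q4 : size Q = 4%N.
  apply/eqP; rewrite eqn_leq (bideg_size hQ) ltnNge; apply/negP => Q3.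
  by have := hQ.2; rewrite nth_default // => /esym/eqP; rewrite polyC_eq0 oner_eq0.
have Qm : Q \is monic by rewrite monicE /lead_coef Q4 hQ.2.
have [s t|[r Qr r2]|[k PQ]] := cubic_square_proportional hQ Qm Q4 hP.
- rewrite PE QE q1E p1E; set y := u1 + _ + _; rewrite !exprMn -!exprVn -exprM.
  have -> : c0^-1 ^+ 2 * ev q y ^+ 2 * (c0^-1 ^+ 2 * p y) =
            c0^-1 ^+ 4 * (ev q y ^+ 2 * p y) by ring.
  by rewrite ler_wpM2l ?p_sqr_le // exprn_even_ge0.
- pose al := r`_0; pose be := r`_1.
  have rE s : r.[s] = al + be * s.
    have -> : r = al%:P + be *: 'X.
      apply/polyP => -[|[|i]]; rewrite coefD coefC coefZ coefX /= ?mulr1 ?mulr0 ?addr0 ?add0r //.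
      by rewrite nth_default // (leq_trans r2).
    by rewrite !(hornerD, hornerC, hornerZ, hornerX).
  have zero s : ev q (u1 + s *: u2 + (al + be * s) *: y0) = 0.
    have /eqP : ev (c0^-1 *: q) (u1 + s *: u2 + (al + be * s) *: y0) = 0.
      rewrite -QE -rE eval2E -[r.[s]]/(horner_eval s r) horner_map Qr.
      by rewrite /= /horner_eval horner0.
    by rewrite q1E mulf_eq0 invr_eq0 (negPf q0) => /eqP.
  (* The product of M and S sends the plane y3 = 0 to the span of u1 + al y0 and u2 + be y0. There q
     vanishes, by homogeneity for y1 != 0 and by continuity for y1 = 0. *)
  pose M := mx3 (v3 al 1 0) (v3 be 0 1) (v3 1 0 0).
  have uM : M \in unitmx.
    apply: (@mx3_unit _ _ (mx3 (v3 0 0 1) (v3 1 0 (- al)) (v3 0 1 (- be)))) => x1 x2 x3.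
    by rewrite !v3_mx3; congr v3; ring.
  have ME (y1 y2 : R) : v3 y1 y2 0 *m (M *m S) = (al * y1 + be * y2) *: y0 + y1 *: u1 + y2 *: u2.
    by rewrite mulmxA v3_mx3 vS; congr (_ *: _ + _ *: _ + _ *: _); ring.
  have zero1 (y1 y2 : R) : y1 != 0 -> ev q (v3 y1 y2 0 *m (M *m S)) = 0.
    move=> y10; have -> : v3 y1 y2 0 *m (M *m S) =
        y1 *: (u1 + (y2 / y1) *: u2 + (al + be * (y2 / y1)) *: y0).
      rewrite ME !scalerDr !scalerA [RHS]addrC addrA.
      congr (_ *: _ + _ *: _ + _ *: _); field; exact: y10.
    by rewrite q_homog zero mulr0.
  apply: (@sos_det_plane (M *m S)) => //; first by rewrite unitmx_mul uM.
  move=> y1 y2; rewrite det_square.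
  suff -> : ev q (v3 y1 y2 0 *m (M *m S)) = 0 by rewrite expr0n.
  have [->|] := eqVneq y1 0; last exact: zero1.
  have [h hE] := ev_line q (v3 0 y2 0 *m (M *m S)) (v3 1 0 0 *m (M *m S)).
  have := hE 0; rewrite scale0r addr0 => <-.
  apply: eval_limit => t t0; rewrite hE scalemxAl -mulmxDl; apply: etrans (zero1 t y2 t0).
  congr (ev q (_ *m _)); apply/rowP => -[[|[|[|//]]] lt_i]; rewrite !mxE /=; ring.
- apply: (@sos_proportional k y0 B0 q0) => y.
  have {PQ} PQ s t : p (u1 + s *: u2 + t *: y0) = k * ev q (u1 + s *: u2 + t *: y0) ^+ 2.
    have := PQ s t; rewrite PE QE q1E p1E => e.
    have c2 : c0 ^- 2 != 0 by rewrite invr_eq0 sqrf_eq0.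
    by apply: (mulfI c2); rewrite e; field; exact: q0.
  (* Scaling reaches every vector with nonzero u1-coordinate c; the case c = 0 is a limit along
     u1. *)
  have pq a c d : c != 0 -> p (v3 a c d *m S) = k * ev q (v3 a c d *m S) ^+ 2.
    move=> cn0; have -> : v3 a c d *m S = c *: (u1 + (d / c) *: u2 + (a / c) *: y0).
      rewrite vS !scalerDr !scalerA [RHS]addrC addrA.
      congr (_ *: _ + _ *: _ + _ *: _); field; exact: cn0.
    by rewrite p_homog q_homog PQ; ring.
  rewrite -(mulmxKV uS y) [y *m _]v3_eta; move: (y *m invmx S) => x.
  have [->|] := eqVneq (x 0 i1) 0; last exact: pq.
  set a := x 0 i0; set d := x 0 i2.
  have [h hE] := ev_line q (v3 a 0 d *m S) (v3 0 1 0 *m S).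
  have [g gE] := ev_line pm (v3 a 0 d *m S) (v3 0 1 0 *m S).
  have := hE 0; have := gE 0; rewrite scale0r addr0 pmE => <- <-.
  apply/eqP; rewrite -subr_eq0; apply/eqP.
  have -> : g.[0] - k * h.[0] ^+ 2 = (g - k *: h ^+ 2).[0].
    by rewrite !(hornerD, hornerN, hornerZ, horner_exp).
  apply: eval_limit => t t0; rewrite !(hornerD, hornerN, hornerZ, horner_exp) gE hE pmE.
  have -> : v3 a 0 d *m S + t *: (v3 0 1 0 *m S) = v3 a t d *m S.
    rewrite scalemxAl -mulmxDl; congr (_ *m S).
    by apply/rowP => -[[|[|[|//]]] lt_i]; rewrite !mxE /=; ring.
  by rewrite pq // subrr.
Qed.

End SquareDet.
End ZeroDet.
End Assembly.

Theorem theorem2p7 (R : realType) (C : tensor4 R) :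
  quasiconvex (quad_form C) ->
  perfect_square (\det (ymatrix C)) ->
  extremal (quad_form C) \/
  polyconvex (quad_form C) \/
  exists (B : 'M[R]_3) (D : tensor4 R),
    [/\ B != 0,
        extremal (quad_form D),
        \det (ymatrix D) = 0 &
        forall xi : 'M[R]_3,
          quad_form C xi = rank_one_form B xi + quad_form D xi].
Proof.
move=> qc [q detC]; have [|next] := EM (extremal (quad_form C)); first by left.
right; left; apply: sos_polyconvex.
have [B B0 qB] : exists2 B : 'M[R]_3, B != 0 &
    quasiconvex (fun xi => quad_form C xi - rank_one_form B xi).
  by apply: contrapT => nB; apply: next.
apply: (sos_square_det (q := q) (B := B)) => // y.
by rewrite /eval_ymatrix det_map_mx detC rmorphXn.
Qed.
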